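(* For $n>2$ there is no rank-2 real vector bundle $\mathcal E^2$ over $\mathbb S^n$ whose total space is top-ALE.
   Context: A manifold $X$ is top-AC if there exist a compact $\mathcal K\subset X$ and closed manifolds $\mathcal N_j$ such that $X\setminus\mathcal K$ is a disjoint union of ends each homeomorphic to $(0,\infty)\times\mathcal N_j$ (link $\mathcal N_j$). It is simple if each $\mathcal N_j=\widetilde{\mathcal N}_j/\Gamma_j$ for a finite group $\Gamma_j$ acting freely on $\widetilde{\mathcal N}_j$, and top-ALE if moreover every $\widetilde{\mathcal N}_j$ is homeomorphic to a sphere. *)

(* Defs.v *)
From HB Require Import structures.
From mathcomp Require Import all_boot all_order all_algebra all_fingroup.
From mathcomp Require Import all_classical all_reals all_analysis.
Set Implicit Arguments. Unset Strict Implicit. Unset Printing Implicit Defensive.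
Import Order.TTheory GRing.Theory Num.Theory.
Import numFieldNormedType.Exports.
Local Open Scope classical_set_scope.
Local Open Scope ring_scope.

Definition homeo_between {T U : topologicalType} (A : set T) (B : set U)
  (f : T -> U) (g : U -> T) : Prop :=
  [/\ {within A, continuous f}, {within B, continuous g},
      (forall x, A x -> B (f x)) & (forall y, B y -> A (g y))] /\
  (forall x, A x -> g (f x) = x) /\ (forall y, B y -> f (g y) = y).

Definition homeomorphic {T U : topologicalType} (A : set T) (B : set U) : Prop :=
  exists f g, homeo_between A B f g.

Definition sphere (R : realType) (k : nat) : set 'rV[R]_(k.+1) :=
  [set x | \sum_(i < k.+1) x ord0 i ^+ 2 = 1].
Arguments sphere : clear implicits.

Definition second_countable (T : topologicalType) : Prop :=
  exists B : set (set T), countable B /\ (forall b, B b -> open b) /\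
    forall x V, open V -> V x -> exists b, [/\ B b, b x & b `<=` V].

Definition manifold_of_dim (R : realType) (d : nat) (X : topologicalType) : Prop :=
  [/\ hausdorff_space X, second_countable X &
      forall x : X, exists U : set X, [/\ open U, U x &
        exists V : set 'rV[R]_d, open V /\ homeomorphic U V]].

Definition is_manifold (R : realType) (X : topologicalType) : Prop :=
  exists d, manifold_of_dim R d X.

Definition closed_manifold (R : realType) (X : topologicalType) : Prop :=
  is_manifold R X /\ compact [set: X].

Definition free_finite_quotient (Nt N : topologicalType) (G : finGroupType)
  (act : G -> Nt -> Nt) (q : Nt -> N) : Prop :=
  [/\ (forall x, act 1%g x = x),
      (forall g h x, act (g * h)%g x = act g (act h x)),
      (forall g, continuous (act g)) &
      (forall g x, act g x = x -> g = 1%g)] /\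
  [/\ continuous q, (forall y, exists x, q x = y),
      (forall V : set N, open (q @^-1` V) -> open V) &
      (forall x y, q x = q y <-> exists g, y = act g x)].

Definition topALE (R : realType) (X : topologicalType) : Prop :=
  is_manifold R X /\
  exists (K : set X) (J : finType) (N : J -> topologicalType) (Ends : J -> set X),
    [/\ compact K,
        (forall j, closed_manifold R (N j)),
        (forall i j, i != j -> Ends i `&` Ends j = set0),
        \bigcup_j Ends j = ~` K &
        (forall j, open (Ends j))] /\
    [/\
        (forall j, homeomorphic (Ends j) [set z : (R * N j)%type | 0 < z.1]) &
        (forall j, exists (Nt : topologicalType) (G : finGroupType)
                     (act : G -> Nt -> Nt) (q : Nt -> N j),
           free_finite_quotient act q /\
           exists k, homeomorphic [set: Nt] (sphere R k))].

Definition rank_vector_bundle_over_sphere (R : realType) (n r : nat)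
  (E : topologicalType) (p : E -> 'rV[R]_(n.+1)) : Prop :=
  continuous p /\ (forall e, sphere R n (p e)) /\
  exists (I : Type) (U : I -> set 'rV[R]_(n.+1))
         (phi : I -> E -> ('rV[R]_(n.+1) * 'rV[R]_r)%type)
         (psi : I -> ('rV[R]_(n.+1) * 'rV[R]_r)%type -> E),
    [/\ (forall i, exists O, open O /\ U i = sphere R n `&` O),
        (forall b, sphere R n b -> exists i, U i b) &
        (forall i, U i `<=` sphere R n)] /\
    [/\
        (forall i, homeo_between (p @^-1` U i)
                     [set z | U i z.1] (phi i) (psi i)),
        (forall i e, U i (p e) -> (phi i e).1 = p e) &
        (forall i j b, U i b -> U j b -> exists M : 'M[R]_r,
           forall v, (phi j (psi i (b, v))).2 = v *m M)].
Arguments rank_vector_bundle_over_sphere : clear implicits.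

(* Main.v *)
Require Import Defs.
From HB Require Import structures.
From mathcomp Require Import all_boot all_order all_algebra all_fingroup.
From mathcomp Require Import all_classical all_reals all_analysis.
From mathcomp Require Import ring lra.
Set Implicit Arguments. Unset Strict Implicit. Unset Printing Implicit Defensive.
Import Order.TTheory GRing.Theory Num.Theory.
Import numFieldNormedType.Exports.
Local Open Scope classical_set_scope.
Local Open Scope ring_scope.

(** For [n >= 3] a rank-2 bundle over [S^n] is trivial: it is trivial over each closed
    hemisphere, and the transition function [S^(n-1) -> GL_2] extends over a hemisphere because
    its rotation angle lifts to the reals ([S^(n-1)] being simply connected).  So the total space
    carries [W : E -> R^2], a linear isomorphism on each fibre.  Fix one fibre; far out it lies in
    a single end [(0,oo) x N], [N = S^l / G], and its large circles escape to one side of that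
    end.  If [l >= 2], far enough on that side [W] does not vanish, hence has a continuous
    argument on (interval) x [S^l]; the argument is invariant under the finite group [G], so it
    descends to (interval) x [N], which contains a circle on which [W] winds once: contradiction.
    If [l <= 1], sections of [S^l -> N] and [(t, x) |-> t x] embed an open part of the total
    space in the plane, which a two-dimensional Borsuk-Ulam argument excludes. *)

(** * Continuity on subsets *)

(** The contradiction is one of fundamental groups. Away from a compact set a trivial rank-2 bundle
    looks like a half-line times [S^1 x S^n], with infinite fundamental group, while a cylinder over
    [S^l / G] with [l >= 2] has the finite fundamental group [G]; the winding number of [W] is the
    homomorphism to the integers that tells them apart. No fundamental group is formed: simple
    connectivity enters only as the existence of continuous arguments, a statement proved once and
    applied both to the transition function on [S^(n-1)] and to the sphere covering the link. For
    [n = 2] the first application fails, and indeed complex line bundles of nonzero Euler class over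
    [S^2] have a top-ALE total space. Two features of the definition shape the rest. The dimension
    [l] of the covering sphere is not tied to that of the total space, so [l <= 1], where the sphere
    is not simply connected, has to be excluded separately. And a homeomorphism of an end with
    [(0,oo) x N] does not say which side is far from the compact set, so both sides are treated, by
    reflecting the radial coordinate. *)

Definition cont_on {T U : topologicalType} (A : set T) (f : T -> U) : Prop :=
  forall x, A x -> f @ within A (nbhs x) --> f x.

Section cont_on.
Context {T U V : topologicalType}.
Implicit Types (A B : set T) (f : T -> U).

Lemma cont_onP A f : {within A, continuous f} <-> cont_on A f.
Proof. exact: subspace_continuousP. Qed.

Lemma cont_onT f : continuous f <-> cont_on setT f.
Proof.
split=> cf x; first by move=> _; exact: cvg_within_filter (cf x).
move=> W /(cf x I); rewrite /= !nbhs_simpl /within /=.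
by apply: filterS => y; exact.
Qed.

Lemma cont_on_continuous A f : continuous f -> cont_on A f.
Proof. by move=> cf x Ax; exact: cvg_within_filter (cf x). Qed.

Lemma cont_on_sub A B f : A `<=` B -> cont_on B f -> cont_on A f.
Proof.
move=> AB cf x Ax; apply: cvg_trans (cf x (AB _ Ax)); apply: cvg_app.
exact: within_subset.
Qed.

Lemma cont_on_eq A f g : {in A, f =1 g} -> cont_on A f -> cont_on A g.
Proof.
move=> fg cf x Ax; rewrite -(fg x) ?inE//.
by apply: cvg_trans _ (cf x Ax); apply: fmap_within_eq => ? ?; rewrite fg.
Qed.

Lemma cont_on_comp A (B : set U) f (g : U -> V) :
  cont_on A f -> cont_on B g -> (forall x, A x -> B (f x)) ->
  cont_on A (fun x => g (f x)).
Proof.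
move=> cf cg AB x Ax W /(cg _ (AB _ Ax)) gW.
have := cf x Ax _ gW; rewrite /= !nbhs_simpl /within /= => H.
by apply: filterS H => y H Ay; apply: H => //; apply: AB.
Qed.

Lemma cont_on_local A f :
  (forall x, A x -> exists O, [/\ open O, O x & cont_on (A `&` O) f]) ->
  cont_on A f.
Proof.
move=> loc x Ax; have [ O [oO Ox cf0]] := loc x Ax; have cf := cf0 x (conj Ax Ox).
move=> W /cf /=; rewrite !nbhs_simpl /within /= => H.
have Oy : nbhs x O by exact: open_nbhs_nbhs.
by apply: filterS2 H Oy => y + Oy Ay; apply.
Qed.

Lemma cont_on_preim A f (O : set U) x : cont_on A f -> open O -> A x -> O (f x) ->
  exists P, [/\ open P, P x & forall y, P y -> A y -> O (f y)].
Proof.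
move=> cf oO Ax Ofx; have := cf x Ax O (open_nbhs_nbhs (conj oO Ofx)).
rewrite /= nbhs_simpl /within /= nbhsE => -[P [oP Px] PA].
by exists P; split=> // y /PA.
Qed.

Lemma open_preim A f (O : set U) : cont_on A f -> open A -> open O ->
  open (A `&` f @^-1` O).
Proof.
move=> cf oA oO; rewrite openE => x [Ax Ofx].
have [P [oP Px PA]] := cont_on_preim cf oO Ax Ofx.
apply: (@filterS _ _ _ (P `&` A)); first by move=> y [Py Ay]; split => //; exact: PA.
exact: (open_nbhs_nbhs (conj (openI oP oA) (conj Px Ax))).
Qed.

Lemma cont_on_pair A f (g : T -> V) :
  cont_on A f -> cont_on A g -> cont_on A (fun x => (f x, g x)).
Proof. by move=> cf cg x Ax; apply: cvg_pair; [exact: cf|exact: cg]. Qed.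

Lemma cont_on_cst A (c : U) : cont_on A (fun=> c).
Proof. by move=> x _; exact: cvg_cst. Qed.

End cont_on.

Lemma cont_on_id (T : topologicalType) (A : set T) : cont_on A id.
Proof. by apply: cont_on_continuous => x; exact: cvg_id. Qed.

Lemma continuous_cont_on (T U V : topologicalType) (A : set T) (f : T -> U) (g : U -> V) :
  continuous g -> cont_on A f -> cont_on A (fun x => g (f x)).
Proof.
by move=> cg cf; apply: (cont_on_comp cf (cont_on_continuous (A := setT) cg)).
Qed.

Section cont_on_prod.
Context {T U V : topologicalType}.
Lemma cont_on_fst (A : set T) (f : T -> U * V) : cont_on A f -> cont_on A (fun x => (f x).1).
Proof.
move=> cf x Ax; apply: cvg_comp (cf x Ax) _; exact: cvg_fst.
Qed.
Lemma cont_on_snd (A : set T) (f : T -> U * V) : cont_on A f -> cont_on A (fun x => (f x).2).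
Proof.
move=> cf x Ax; apply: cvg_comp (cf x Ax) _; exact: cvg_snd.
Qed.
End cont_on_prod.

Section cont_on_real.
Context {T : topologicalType} {R : realType}.
Implicit Types (A : set T) (f g : T -> R).

Lemma cont_onD A f g : cont_on A f -> cont_on A g -> cont_on A (fun x => f x + g x).
Proof. by move=> cf cg x Ax; apply: cvgD; [exact: cf|exact: cg]. Qed.

Lemma cont_onM A f g : cont_on A f -> cont_on A g -> cont_on A (fun x => f x * g x).
Proof. by move=> cf cg x Ax; apply: cvgM; [exact: cf|exact: cg]. Qed.

Lemma cont_onN A f : cont_on A f -> cont_on A (fun x => - f x).
Proof. by move=> cf x Ax; apply: cvgN; exact: cf. Qed.

Lemma cont_onV A f : (forall x, A x -> f x != 0) -> cont_on A f ->
  cont_on A (fun x => (f x)^-1).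
Proof. by move=> f0 cf x Ax; apply: cvgV; [exact: f0|exact: cf]. Qed.

Lemma cont_onX A f n : cont_on A f -> cont_on A (fun x => f x ^+ n).
Proof.
move=> cf; elim: n => [|n IH]; first exact: cont_on_cst.
by rewrite (_ : (fun x => _) = fun x => f x * f x ^+ n);
  [exact: cont_onM|apply/funext => x; rewrite exprS].
Qed.

Lemma cont_on_sum A (I : Type) (r : seq I) (P : pred I) (F : I -> T -> R) :
  (forall i, P i -> cont_on A (F i)) -> cont_on A (fun x => \sum_(i <- r | P i) F i x).
Proof.
move=> cF x Ax; apply: cvg_big; last by move=> i Pi; exact: cF.
by move=> z; exact: add_continuous.
Qed.

Lemma cont_on_prod A (I : Type) (r : seq I) (P : pred I) (F : I -> T -> R) :
  (forall i, P i -> cont_on A (F i)) -> cont_on A (fun x => \prod_(i <- r | P i) F i x).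
Proof.
move=> cF x Ax; apply: cvg_big; last by move=> i Pi; exact: cF.
by move=> z; exact: mul_continuous.
Qed.

Lemma cont_on_cos A f : cont_on A f -> cont_on A (fun x => cos (f x)).
Proof. by apply: continuous_cont_on; exact: continuous_cos. Qed.

Lemma cont_on_sin A f : cont_on A f -> cont_on A (fun x => sin (f x)).
Proof. by apply: continuous_cont_on; exact: continuous_sin. Qed.

Lemma cont_on_atan A f : cont_on A f -> cont_on A (fun x => atan (f x)).
Proof. by apply: continuous_cont_on; exact: continuous_atan. Qed.

Lemma cont_on_sqrt A f : cont_on A f -> cont_on A (fun x => Num.sqrt (f x)).
Proof. by apply: continuous_cont_on; exact: sqrt_continuous. Qed.

Lemma cont_on_norm A f : cont_on A f -> cont_on A (fun x => `|f x|).
Proof. by move=> cf x Ax; apply: cvg_norm; exact: cf. Qed.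

Lemma cont_on_coord m n A (f : T -> 'M[R]_(m, n)) i j :
  cont_on A f -> cont_on A (fun x => f x i j).
Proof. exact: (continuous_cont_on (@coord_continuous _ m n i j)). Qed.

Lemma cont_on_mx m n A (f : T -> 'M[R]_(m, n)) :
  (forall i j, cont_on A (fun x => f x i j)) -> cont_on A f.
Proof.
move=> cf x Ax W [P fP PW]; rewrite nbhs_simpl /=.
apply: (@filterS _ _ _ [set y | forall i j, P i j (f y i j)]) => [y Py|].
  exact: (PW _ (fun i j => Py i j)).
have FF : Filter (within A (nbhs x)) by exact: within_filter.
apply: (@filter_forall _ _ (fun i => [set y | forall j, P i j (f y i j)]) _ FF) => i.
apply: (@filter_forall _ _ (fun j => [set y | P i j (f y i j)]) _ FF) => j.
by apply: (cf i j x Ax); exact: fP.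
Qed.

Lemma cont_on_mulmx m n p A (f : T -> 'M[R]_(m, n)) (g : T -> 'M[R]_(n, p)) :
  cont_on A f -> cont_on A g -> cont_on A (fun x => f x *m g x).
Proof.
move=> cf cg; apply: cont_on_mx => i j.
rewrite (_ : (fun x => _) = fun x => \sum_k f x i k * g x k j); last first.
  by apply/funext => x; rewrite mxE.
by apply: cont_on_sum => k _; apply: cont_onM; exact: cont_on_coord.
Qed.

Lemma cont_on_det n A (f : T -> 'M[R]_n) : cont_on A f -> cont_on A (fun x => \det (f x)).
Proof.
move=> cf; rewrite /determinant; apply: cont_on_sum => s _.
apply: cont_onM; first exact: cont_on_cst.
by apply: cont_on_prod => i _; exact: cont_on_coord.
Qed.

Lemma cont_on_invmx n A (f : T -> 'M[R]_n) : (forall x, A x -> f x \in unitmx) ->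
  cont_on A f -> cont_on A (fun x => invmx (f x)).
Proof.
move=> fu cf; apply: cont_on_mx => i j.
apply: (@cont_on_eq _ _ _ (fun x => (\det (f x))^-1 * cofactor (f x) j i)).
  by move=> x; rewrite inE => Ax; rewrite /invmx fu // !mxE.
apply: cont_onM.
  apply: cont_onV (cont_on_det cf) => x Ax.
  by have := fu x Ax; rewrite unitmxE unitfE.
apply: cont_onM; first exact: cont_on_cst.
apply: cont_on_det; apply: cont_on_mx => k l.
rewrite (_ : (fun x => _) = fun x => f x (lift j k) (lift i l)); last first.
  by apply/funext => x; rewrite !mxE.
exact: cont_on_coord.
Qed.

End cont_on_real.

Lemma connected_image (T U : topologicalType) (A : set T) (f : T -> U) :
  connected A -> cont_on A f -> connected (f @` A).
Proof. by move=> cA /cont_onP; exact: connected_continuous_connected. Qed.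

Lemma compact_image (T U : topologicalType) (A : set T) (f : T -> U) :
  compact A -> cont_on A f -> compact (f @` A).
Proof. by move=> cA /cont_onP cf; exact: continuous_compact. Qed.

Section real_valued.
Context {T : topologicalType} {R : realType}.
Implicit Types (A : set T) (f : T -> R).

Lemma connected_pos A f (c : R) x0 : connected A -> cont_on A f ->
  (forall x, A x -> f x != c) -> A x0 -> c < f x0 -> forall x, A x -> c < f x.
Proof.
move=> cA cf fc Ax0 f0 x Ax; rewrite ltNge; apply/negP => fxc.
have /connected_intervalP int := connected_image cA cf.
have [y Ay yc] : (f @` A) c.
  by apply: (int (f x) (f x0)); [exists x|exists x0|rewrite fxc ltW].
by have := fc y Ay; rewrite yc eqxx.
Qed.

Lemma connected_neg A f (c : R) x0 : connected A -> cont_on A f ->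
  (forall x, A x -> f x != c) -> A x0 -> f x0 < c -> forall x, A x -> f x < c.
Proof.
move=> cA cf fc Ax0 f0 x Ax.
have := @connected_pos A (fun x => - f x) (- c) x0 cA (cont_onN cf).
rewrite ltrN2 => /(_ _ Ax0 f0 x Ax); rewrite ltrN2; apply => y /fc.
by rewrite eqr_opp.
Qed.

Lemma compact_ub A f : compact A -> cont_on A f -> exists M, forall x, A x -> f x <= M.
Proof.
move=> cA cf; have := compact_image cA cf => /compact_bounded[M [_ HM]].
exists (M + 1) => x Ax; apply: le_trans (ler_norm _) _.
by apply: (HM (M + 1)); [rewrite ltrDl|exists x].
Qed.

(** The condition [cos (d x) = 1] encodes that [d x] is a multiple of [2 pi]. If two values
    differed, the values in between would include one at distance [e] from the smaller, with
    [0 < e <= pi / 2], and there the cosine is already below 1. *)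
Lemma connected_cos1_cst A d : connected A -> cont_on A d ->
  (forall x, A x -> cos (d x) = 1 :> R) -> forall x y, A x -> A y -> d x = d y.
Proof.
move=> cA cd d1; suff H x y : A x -> A y -> ~ d x < d y.
  by move=> x y Ax Ay; case: (ltgtP (d x) (d y)) => // /H; [move/(_ Ax Ay)|move/(_ Ay Ax)].
move=> Ax Ay dxy.
have /connected_intervalP int := connected_image cA cd.
pose e := Num.min (d y - d x) (pi / 2).
have pi2 : 0 < pi / 2 :> R by rewrite divr_gt0// pi_gt0.
have e0 : 0 < e by rewrite lt_min pi2 subr_gt0 dxy.
have ey : e <= d y - d x by rewrite ge_min lexx.
have epi : e <= pi / 2 by rewrite ge_min lexx orbT.
have [z Az dz] : (d @` A) (d x + e).
  by apply: (int (d x) (d y)); [exists x|exists y|lra].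
have := d1 z Az; rewrite dz cosD d1//.
have -> : sin (d x) = 0.
  by apply: cos1sin0; rewrite d1// normr1.
rewrite mul1r mul0r subr0 => ce.
have : cos e < cos 0; last by rewrite cos0 ce ltxx.
rewrite ltr_cos ?in_itv/= ?lexx ?pi_ge0//.
by rewrite ltW//= (le_trans epi)// ler_pdivrMr// ler_peMr ?pi_ge0// ler1n.
Qed.

End real_valued.

(** * Continuous arguments and boxes *)

Definition is_arg {R : realType} (a b t : R) : Prop :=
  exists2 r, 0 < r & a = r * cos t /\ b = r * sin t.

Section is_arg.
Context {R : realType}.
Implicit Types a b t : R.

Lemma is_arg_exists a b : a ^+ 2 + b ^+ 2 != 0 -> exists t, is_arg a b t.
Proof.
move=> ab0; pose r := Num.sqrt (a ^+ 2 + b ^+ 2).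
have ab : 0 < a ^+ 2 + b ^+ 2 by rewrite lt_neqAle eq_sym ab0 addr_ge0// sqr_ge0.
have r0 : 0 < r by rewrite sqrtr_gt0.
have r2 : r ^+ 2 = a ^+ 2 + b ^+ 2 by rewrite sqr_sqrtr// ltW.
have rn : r != 0 by rewrite gt_eqF.
have ar : -1 <= a / r <= 1.
  rewrite -ler_norml normrM normfV (gtr0_norm r0) ler_pdivrMr// mul1r.
  rewrite -(ger0_norm (ltW r0)) -ler_sqr ?nnegrE// !real_normK ?num_real//.
  by rewrite r2 lerDl sqr_ge0.
have ca : r * cos (acos (a / r)) = a by rewrite acosK// mulrC divfK.
have sa : r * sin (acos (a / r)) = `|b|.
  rewrite sin_acos//.
  have -> : 1 - (a / r) ^+ 2 = (b / r) ^+ 2.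
    by rewrite !expr_div_n; apply: (mulIf (expf_neq0 2 rn)); rewrite mulrBl !divfK ?expf_neq0// mul1r r2; ring.
  by rewrite sqrtr_sqr normrM normfV (gtr0_norm r0) mulrC divfK.
case: (leP 0 b) => b0.
  by exists (acos (a / r)), r => //; rewrite ca sa ger0_norm.
exists (- acos (a / r)), r => //; rewrite cosN sinN ca mulrN sa ltr0_norm//.
by rewrite opprK.
Qed.

Lemma is_arg_cosB a b t t' : is_arg a b t -> is_arg a b t' -> cos (t - t') = 1.
Proof.
move=> [r r0 [ar br]] [s s0 [as_ bs]].
have rs : r = s.
  apply/eqP; rewrite -(eqrXn2 (n:=2)) ?(ltW r0) ?(ltW s0)//; apply/eqP.
  transitivity (a ^+ 2 + b ^+ 2); rewrite ?ar ?br ?as_ ?bs.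
    by rewrite !exprMn -mulrDr cos2Dsin2 mulr1.
  by rewrite -ar as_ -br bs !exprMn -mulrDr cos2Dsin2 mulr1.
rewrite -{}rs in as_ bs; apply: (mulfI (expf_neq0 2 (lt0r_neq0 r0))).
rewrite cosB mulr1; transitivity (a ^+ 2 + b ^+ 2).
  by rewrite !expr2 {1}ar {1}br as_ bs; ring.
by rewrite ar br !exprMn -mulrDr cos2Dsin2 mulr1.
Qed.

Lemma is_argD a b t d : is_arg a b t -> cos d = 1 -> is_arg a b (t + d).
Proof.
move=> [r r0 [-> ->]] d1; exists r => //.
have sd : sin d = 0 by apply: cos1sin0; rewrite d1 normr1.
by rewrite cosD sinD d1 sd !mulr1 !mulr0 subr0 addr0.
Qed.

(** In the frame turned by an argument [t0] of the vector at [x], the vector has coordinates [p] and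
    [q]. At [x] it points along the first axis, so [p] stays positive nearby and [t0 + atan (q / p)]
    is an argument. *)
Lemma is_arg_local (T : topologicalType) (A : set T) (u v : T -> R) x :
  cont_on A u -> cont_on A v -> A x -> u x ^+ 2 + v x ^+ 2 != 0 ->
  exists O th, [/\ open O, O x, cont_on (A `&` O) th &
    forall y, A y -> O y -> is_arg (u y) (v y) (th y)].
Proof.
move=> cu cv Ax /is_arg_exists[t0 [r0 r0_gt0 [ur vr]]].
pose p y := u y * cos t0 + v y * sin t0.
pose q y := v y * cos t0 - u y * sin t0.
have cp : cont_on A p.
  by apply: cont_onD; apply: cont_onM => //; exact: cont_on_cst.
have cq : cont_on A q.
  by apply: cont_onD; [|apply: cont_onN]; apply: cont_onM => //; exact: cont_on_cst.
have px : [set z : R | 0 < z] (p x).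
  rewrite /= /p ur vr (_ : _ + _ = r0 * (cos t0 ^+ 2 + sin t0 ^+ 2)); last by ring.
  by rewrite cos2Dsin2 mulr1.
have [ O [oO Ox OA]] := cont_on_preim cp (@open_gt R 0) Ax px.
exists O, (fun y => t0 + atan (q y / p y)); split=> //.
  apply: cont_onD; first exact: cont_on_cst.
  apply: cont_on_atan; apply: cont_onM.
    by apply: cont_on_sub cq => y [].
  apply: cont_onV; last by apply: cont_on_sub cp => y [].
  by move=> y [Ay Oy]; rewrite gt_eqF//; exact: OA.
move=> y Ay Oy; have py : 0 < p y by exact: OA.
set f := atan _.
have cf : 0 < cos f by apply: cos_gt0_pihalf; rewrite atan_gtNpi2 atan_ltpi2.
have tf : q y = p y / cos f * sin f.
  rewrite -mulrA [_^-1 * _]mulrC -[sin f / cos f]/(tan f) atanK.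
  by rewrite mulrC divfK// gt_eqF.
have pf : p y = p y / cos f * cos f by rewrite divfK// gt_eqF.
exists (p y / cos f); first by rewrite divr_gt0.
rewrite cosD sinD !mulrDr mulrN.
have s2 : sin t0 ^+ 2 = 1 - cos t0 ^+ 2 by exact: sin2cos2.
split.
  transitivity (p y * cos t0 - q y * sin t0); last first.
    by rewrite {1}tf {1}pf; ring.
  rewrite /p /q (_ : _ - _ = u y * (cos t0 ^+ 2 + sin t0 ^+ 2)); last by ring.
  by rewrite cos2Dsin2 mulr1.
transitivity (p y * sin t0 + q y * cos t0); last first.
  by rewrite {1}tf {1}pf; ring.
rewrite /p /q (_ : _ + _ = v y * (cos t0 ^+ 2 + sin t0 ^+ 2)); last by ring.
by rewrite cos2Dsin2 mulr1.
Qed.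

End is_arg.

Definition box {R : realType} m (a b : 'rV[R]_m) : set 'rV[R]_m :=
  [set x | forall i, a 0 i <= x 0 i <= b 0 i].

Definition upd {R : realType} m (a : 'rV[R]_m) i c : 'rV[R]_m :=
  \row_j (if j == i then c else a 0 j).

Section box.
Context {R : realType} {m : nat}.
Implicit Types a b x : 'rV[R]_m.

Lemma box_compact a b : compact (box a b).
Proof.
have := @rV_compact R m (fun i => `[a 0 i, b 0 i]%classic) (fun i => @segment_compact _ _ _).
by congr compact; apply/seteqP; split => x /= H i; have := H i; rewrite in_itv.
Qed.

Lemma segment_connected_rV a b (A : set 'rV[R]_m) :
  (forall t : R, 0 <= t <= 1 -> A (a + t *: (b - a))) ->
  exists C, [/\ connected C, C a, C b & C `<=` A].
Proof.
move=> H; exists ((fun t : R => a + t *: (b - a)) @` `[0, 1]%classic); split.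
- apply: connected_image; first exact: segment_connected.
  apply: cont_on_mx => i j.
  rewrite (_ : (fun x : R => _) = fun t : R => a i j + t * (b - a) i j); last first.
    by apply/funext => t; rewrite !mxE.
  apply: cont_onD; first exact: cont_on_cst.
  by apply: cont_onM; [exact: cont_on_id|exact: cont_on_cst].
- by exists 0; rewrite ?scale0r ?addr0//= in_itv/= lexx ler01.
- by exists 1; rewrite ?scale1r ?subrKC//= in_itv/= lexx ler01.
- by move=> _ [t /= + <-]; rewrite in_itv/= => /H.
Qed.

Lemma connected_from (T : topologicalType) (A : set T) (x0 : T) : A x0 ->
  (forall x : T, A x -> exists C, [/\ connected C, C x0, C x & C `<=` A]) -> connected A.
Proof.
move=> Ax0 H.
pose P := [set C : set T | [/\ connected C, C x0 & C `<=` A]].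
rewrite (_ : A = \bigcup_(C in P) C).
  apply: bigcup_connected; first by exists x0 => C [].
  by move=> C [].
apply/seteqP; split => [x /H[C [cC C0 Cx CA]]|x [C [_ _ CA] /CA//]].
by exists C.
Qed.

Lemma box_connected a b : connected (box a b).
Proof.
have [->|/set0P[x0 bx0]] := eqVneq (box a b) set0; first exact: connected0.
apply: (@connected_from _ _ x0) => // x bx; apply: segment_connected_rV => t /andP[t0 t1] i.
rewrite !mxE; have /andP[h1 h2] := bx0 i; have /andP[h3 h4] := bx i.
by apply/andP; split; nra.
Qed.

Lemma coord_ge_closed (i : 'I_m) (c : R) : closed [set x : 'rV[R]_m | c <= x 0 i].
Proof.
by apply: (@closed_comp _ _ (fun x : 'rV[R]_m => x 0 i) [set z | c <= z]) => [x _|];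
  [exact: coord_continuous|exact: closed_ge].
Qed.

Lemma coord_le_closed (i : 'I_m) (c : R) : closed [set x : 'rV[R]_m | x 0 i <= c].
Proof.
by apply: (@closed_comp _ _ (fun x : 'rV[R]_m => x 0 i) [set z | z <= c]) => [x _|];
  [exact: coord_continuous|exact: closed_le].
Qed.

(** A Lebesgue number: compactness makes the local radius uniform, half of it being given up to the
    triangle inequality. *)
Lemma box_uniform (P : 'rV[R]_m -> 'rV[R]_m -> Prop) a0 b0 :
  (forall x, box a0 b0 x -> exists2 e, 0 < e &
    forall a b, box a b `<=` ball x e -> P a b) ->
  exists2 e, 0 < e & forall x, box a0 b0 x ->
    forall a b, box a b `<=` ball x e -> P a b.
Proof.
move=> loc.
have /compact_near_coveringP cov := @box_compact a0 b0.
have : \forall e \near (0 : R)^'+, box a0 b0 `<=`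
    (fun x => forall a b, box a b `<=` ball x e -> P a b).
  apply: cov => x /loc[e e0 He]; exists (ball x (e / 2), [set d | d < e / 2]).
    split=> /=; first by apply: nbhsx_ballx; rewrite divr_gt0.
    by apply: nbhs_right_lt; rewrite divr_gt0.
  move=> [x' d] /= [xx' de] a b ab; apply: He => y /ab x'y.
  rewrite (splitr e); apply: ball_triangle xx' _.
  by apply: le_ball x'y; exact: ltW.
move=> H; have : \forall e \near (0 : R)^'+, 0 < e /\ box a0 b0 `<=`
    (fun x => forall a b, box a b `<=` ball x e -> P a b).
  by near=> e; split; [near: e; exact: nbhs_right_gt|near: e].
by move=> /filter_ex[e [e0 He]]; exists e.
Unshelve. all: by end_near.
Qed.

Lemma updE a i c j : upd a i c 0 j = if j == i then c else a 0 j.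
Proof. by rewrite mxE. Qed.

(* By compactness [P] holds on all boxes of side at most [d / 2]; halving one coordinate at a
   time, induct on the total number of halvings needed. *)
Lemma box_ind (P : 'rV[R]_m -> 'rV[R]_m -> Prop) a0 b0 :
  (forall x, box a0 b0 x -> exists2 e, 0 < e &
    forall a b, box a b `<=` ball x e -> P a b) ->
  (forall a b i c, (forall j, a 0 j <= b 0 j) -> a 0 i <= c <= b 0 i ->
    P a (upd b i c) -> P (upd a i c) b -> P a b) ->
  (forall i, a0 0 i <= b0 0 i) -> P a0 b0.
Proof.
move=> loc glue ab0; have [d d0 Pd] := box_uniform loc.
have claim N : forall e : 'I_m -> nat, (\sum_i e i <= N)%N ->
    forall a b, (forall i, a 0 i <= b 0 i) -> box a0 b0 a ->
      (forall i, b 0 i <= b0 0 i) ->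
      (forall i, b 0 i - a 0 i <= d / 2 * 2 ^+ e i) -> P a b.
  elim: N => [|N IH] e eN a b ab ba0 bb0 dab.
    apply: (Pd a) => // x bx; split=> // k i; rewrite ord1 /ball/=.
    move: (eN); rewrite leqn0 sum_nat_eq0 => /forallP/(_ i)/eqP ei.
    have := dab i; rewrite ei expr0 mulr1 => abi.
    have /andP[h1 h2] := bx i; rewrite distrC ger0_norm ?subr_ge0//.
    have : d / 2 < d by rewrite ltr_pdivrMr// ltr_pMr// ltr1n.
    by lra.
  have [/existsP[i ei]|/existsPn e0] := boolP [exists i, 0 < e i]%N; last first.
    apply: (IH e) => //; rewrite big1// => i _; apply/eqP.
    by have := e0 i; rewrite -leqNgt leqn0.
  pose e' j := if j == i then (e i).-1 else e j.
  have e'N : (\sum_j e' j <= N)%N.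
    rewrite -ltnS; apply: leq_trans eN.
    rewrite (bigD1 i)//= [X in (_ < X)%N](bigD1 i)//= /e' eqxx.
    rewrite -addSn prednK// leq_add2l; apply: leq_sum => j /negbTE ->//.
  pose c := (a 0 i + b 0 i) / 2.
  have /andP[c1 c2] : a 0 i <= c <= b 0 i by have := ab i; rewrite /c => ?; apply/andP; split; lra.
  have ci : d / 2 * 2 ^+ e i = (d / 2 * 2 ^+ (e i).-1) * 2.
    by rewrite -{1}(prednK ei) exprS; ring.
  apply: (glue a b i c) => //; first by rewrite c1.
  - apply: (IH e') => // j; rewrite ?updE /e'; case: eqP => [->|_] //.
      exact: (le_trans c2).
    by have := dab i; rewrite ci /c; lra.
  - apply: (IH e') => // j; rewrite ?updE /e'; case: eqP => [->|_] //.
    + by rewrite (le_trans c2)// andbT (le_trans _ c1)//; have /andP[] := ba0 i.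
    + by have := dab i; rewrite ci /c; lra.
(* Any natural number above the ratio of the side to [d / 2] is enough halvings, since
   [n < 2 ^ n]. *)
pose e i : nat := Num.bound ((b0 0 i - a0 0 i) / (d / 2)).
apply: (claim _ e (leqnn _)) => //; first by move=> i; rewrite lexx ab0.
move=> i; rewrite mulrC -ler_pdivrMr ?divr_gt0//.
apply: ltW; apply: lt_le_trans (archi_boundP _) _.
  by rewrite divr_ge0 ?subr_ge0// ltW// divr_gt0.
by rewrite -natrX ler_nat ltnW// ltn_expl.
Qed.

End box.

Lemma cont_on_paste (T U : topologicalType) (A B C : set T) (f g h : T -> U) :
  closed A -> closed B -> C `<=` A `|` B ->
  cont_on (C `&` A) f -> cont_on (C `&` B) g ->
  (forall x, C x -> A x -> h x = f x) -> (forall x, C x -> B x -> h x = g x) ->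
  cont_on C h.
Proof.
move=> clA clB CAB cf cg hf hg x Cx W Wx.
suff half (D : set T) (k : T -> U) : closed D -> cont_on (C `&` D) k ->
    (forall x, C x -> D x -> h x = k x) -> \forall y \near x, C y -> D y -> W (h y).
  rewrite nbhs_simpl /within /=.
  apply: filterS2 (half _ _ clA cf hf) (half _ _ clB cg hg) => y WA WB Cy.
  by have [Ay|By] := CAB y Cy; [exact: WA|exact: WB].
move=> clD ck hk; have [Dx|nDx] := pselect (D x).
  have := ck x (conj Cx Dx) W; rewrite -hk// => /(_ Wx).
  rewrite /= !nbhs_simpl /within /=; apply: filterS => y H Cy Dy.
  by rewrite hk//; exact: H.
have oD : open (~` D) by exact: closed_openC.
by apply: filterS (open_nbhs_nbhs (conj oD nDx)) => y nDy _ /nDy.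
Unshelve. all: by end_near.
Qed.

Section box_arg.
Context {R : realType} {m : nat}.
Implicit Types a b x : 'rV[R]_m.

Lemma sub_box a b a' b' : (forall i, a 0 i <= a' 0 i) -> (forall i, b' 0 i <= b 0 i) ->
  box a' b' `<=` box a b.
Proof.
move=> aa bb x bx i; have /andP[h1 h2] := bx i.
by rewrite (le_trans (aa i) h1) (le_trans h2 (bb i)).
Qed.

Section upd.
Variables (a b : 'rV[R]_m) (i : 'I_m) (c : R).
Hypotheses (ab : forall j, a 0 j <= b 0 j) (aci : a 0 i <= c <= b 0 i).

Lemma box_updl : box a (upd b i c) `<=` box a b.
Proof.
by apply: sub_box => // j; rewrite updE; case: eqP => // ->; case/andP: aci.
Qed.

Lemma box_updr : box (upd a i c) b `<=` box a b.
Proof.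
by apply: sub_box => // j; rewrite updE; case: eqP => // ->; case/andP: aci.
Qed.

Lemma in_box_updl x : box a b x -> x 0 i <= c -> box a (upd b i c) x.
Proof.
move=> bx xc j; have /andP[h1 h2] := bx j; rewrite h1 updE /=.
by case: eqP => // ->.
Qed.

Lemma in_box_updr x : box a b x -> c <= x 0 i -> box (upd a i c) b x.
Proof.
move=> bx xc j; have /andP[h1 h2] := bx j; rewrite h2 updE andbT.
by case: eqP => // ->.
Qed.

Lemma box_face x : box (upd a i c) (upd b i c) x ->
  box a (upd b i c) x /\ box (upd a i c) b x.
Proof.
move=> bx; split; apply: sub_box bx => // j; rewrite updE; case: eqP => // ->;
  by case/andP: aci.
Qed.

Lemma box_face_ne : box (upd a i c) (upd b i c) (upd a i c).
Proof. by move=> j; rewrite !updE lexx /=; case: eqP. Qed.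

Lemma box_face_eq x : box a b x -> x 0 i = c -> box (upd a i c) (upd b i c) x.
Proof.
move=> bx xc j; have /andP[h1 h2] := bx j; rewrite !updE.
by case: eqP => [->|_]; rewrite ?xc ?lexx// h1.
Qed.

End upd.

(** Arguments exist locally and are glued by [box_ind]. The common face of two halves is again a
    box, hence connected, so the two arguments differ on it by one fixed multiple of [2 pi], which
    is added to the second. *)
Lemma box_arg (u v : 'rV[R]_m -> R) a b :
  cont_on (box a b) u -> cont_on (box a b) v ->
  (forall x, box a b x -> u x ^+ 2 + v x ^+ 2 != 0) ->
  (forall i, a 0 i <= b 0 i) ->
  exists th, cont_on (box a b) th /\
    forall x, box a b x -> is_arg (u x) (v x) (th x).
Proof.
move=> cu cv uv ab.
(* [box_ind] speaks of arbitrary boxes, while [u] and [v] are controlled only on the original one;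
   the inclusion is therefore carried inside the predicate. *)
suff : box a b `<=` box a b -> exists th, cont_on (box a b) th /\
    forall x, box a b x -> is_arg (u x) (v x) (th x) by exact.
apply: (@box_ind _ _ (fun a' b' => box a' b' `<=` box a b ->
    exists th, cont_on (box a' b') th /\
    forall x, box a' b' x -> is_arg (u x) (v x) (th x)) a b) => //.
  move=> x bx; have [ O [th [oO Ox cth argth]]] := is_arg_local cu cv bx (uv x bx).
  have /nbhs_ballP[e e0 eO] : nbhs x O by exact: open_nbhs_nbhs.
  exists e => // a' b' ball_sub sub; exists th; split.
    by apply: cont_on_sub cth => y bxy; split; [exact: sub|exact/eO/ball_sub].
  by move=> y bxy; apply: argth; [exact: sub|exact/eO/ball_sub].
move=> a' b' i c ab' aci IH1 IH2 sub.
have [th1 [c1 h1]] := IH1 (subset_trans (box_updl aci) sub).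
have [th2 [c2 h2]] := IH2 (subset_trans (box_updr aci) sub).
pose x0 := upd a' i c.
have fcst x : box (upd a' i c) (upd b' i c) x -> th1 x - th2 x = th1 x0 - th2 x0.
  move=> fx; apply: (@connected_cos1_cst _ _ _ (fun x => th1 x - th2 x) (@box_connected _ _ (upd a' i c) (upd b' i c))) => //.
  - apply: cont_onD; [apply: cont_on_sub c1|apply: cont_onN; apply: cont_on_sub c2].
      by move=> y /(box_face aci)[].
    by move=> y /(box_face aci)[].
  - move=> y /(box_face aci)[y1 y2]; exact: is_arg_cosB (h1 y y1) (h2 y y2).
  - exact: box_face_ne.
have kcos : cos (th1 x0 - th2 x0) = 1.
  by have [y1 y2] := box_face aci (box_face_ne i c ab'); exact: is_arg_cosB (h1 _ y1) (h2 _ y2).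
pose th x := if x 0 i <= c then th1 x else th2 x + (th1 x0 - th2 x0).
exists th; split.
  apply: (@cont_on_paste ('rV[R]_m) R [set x | x 0 i <= c] [set x | c <= x 0 i] _
      th1 (fun x => th2 x + (th1 x0 - th2 x0))).
  - exact: coord_le_closed.
  - exact: coord_ge_closed.
  - by move=> x _ /=; case: (leP (x 0 i) c) => [|/ltW] ?; [left|right].
  - by apply: cont_on_sub c1 => x [bx xc]; exact: in_box_updl.
  - apply: cont_onD; last exact: cont_on_cst.
    by apply: cont_on_sub c2 => x [bx xc]; exact: in_box_updr.
  - by move=> x _ /= xc; rewrite /th xc.
  - move=> x bx /= xc; rewrite /th; case: leP => // xc'.
    have {}xc : x 0 i = c by apply/le_anti/andP.
    by rewrite -(fcst x (box_face_eq bx xc)) addrC subrK.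
move=> x bx; rewrite /th; case: leP => xc; first exact/h1/in_box_updl.
by apply: is_argD => //; apply/h2/in_box_updr => //; exact: ltW.
Qed.

End box_arg.

(** * Stereographic coordinates on spheres *)

Definition sqnorm {R : realType} {m} (x : 'rV[R]_m) : R := \sum_i x 0 i ^+ 2.
Definition consr {R : realType} {m} (t : R) (x : 'rV[R]_m) : 'rV[R]_m.+1 :=
  \row_j oapp (x 0) t (unlift ord0 j).
Definition tailr {R : realType} {m} (x : 'rV[R]_m.+1) : 'rV[R]_m :=
  \row_k x 0 (lift ord0 k).

Section consr.
Context {R : realType} {m : nat}.
Implicit Types (t : R) (x : 'rV[R]_m).

Lemma consr0 t x : consr t x 0 0 = t.
Proof. by rewrite mxE unlift_none. Qed.

Lemma consrS t x k : consr t x 0 (lift ord0 k) = x 0 k.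
Proof. by rewrite mxE liftK. Qed.

Lemma consrK t x : tailr (consr t x) = x.
Proof. by apply/rowP => k; rewrite mxE consrS. Qed.

Lemma consr_tailr (y : 'rV[R]_m.+1) : consr (y 0 0) (tailr y) = y.
Proof. by apply/rowP => j; case: (unliftP ord0 j) => [k|] ->; rewrite ?consrS ?consr0 ?mxE. Qed.

Lemma sqnorm_consr t x : sqnorm (consr t x) = t ^+ 2 + sqnorm x.
Proof.
rewrite /sqnorm big_ord_recl consr0; congr (_ + _).
by apply: eq_bigr => k _; rewrite consrS.
Qed.

Lemma sqnorm_ge0 x : 0 <= sqnorm x.
Proof. by apply: sumr_ge0 => i _; exact: sqr_ge0. Qed.

Lemma sqnormZ t x : sqnorm (t *: x) = t ^+ 2 * sqnorm x.
Proof. by rewrite /sqnorm mulr_sumr; apply: eq_bigr => i _; rewrite mxE exprMn. Qed.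

Lemma sqnorm_coord x i : x 0 i ^+ 2 <= sqnorm x.
Proof. by rewrite /sqnorm (bigD1 i)//= lerDl; apply: sumr_ge0 => j _; exact: sqr_ge0. Qed.

Context {T : topologicalType}.
Implicit Types A : set T.

Lemma cont_on_sqnorm A (f : T -> 'rV[R]_m) : cont_on A f -> cont_on A (fun z => sqnorm (f z)).
Proof.
by move=> cf; apply: cont_on_sum => i _; apply: cont_onX; exact: cont_on_coord.
Qed.

Lemma cont_on_consr A (f : T -> R) (g : T -> 'rV[R]_m) :
  cont_on A f -> cont_on A g -> cont_on A (fun z => consr (f z) (g z)).
Proof.
move=> cf cg; apply: cont_on_mx => i j; rewrite ord1.
case: (unliftP ord0 j) => [k|] ->.
  rewrite (_ : (fun z => _) = fun z => g z 0 k); first exact: cont_on_coord.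
  by apply/funext => z; rewrite consrS.
by rewrite (_ : (fun z => _) = f)//; apply/funext => z; rewrite consr0.
Qed.

Lemma cont_on_tailr A (f : T -> 'rV[R]_m.+1) : cont_on A f -> cont_on A (fun z => tailr (f z)).
Proof.
move=> cf; apply: cont_on_mx => i j; rewrite ord1.
rewrite (_ : (fun z => _) = fun z => f z 0 (lift ord0 j)); first exact: cont_on_coord.
by apply/funext => z; rewrite mxE.
Qed.

Lemma cont_onZ p q A (f : T -> R) (g : T -> 'M[R]_(p, q)) :
  cont_on A f -> cont_on A g -> cont_on A (fun z => f z *: g z).
Proof.
move=> cf cg; apply: cont_on_mx => i j.
rewrite (_ : (fun z => _) = fun z => f z * g z i j); last by apply/funext => z; rewrite mxE.
by apply: cont_onM => //; exact: cont_on_coord.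
Qed.

End consr.

(** Inverse stereographic projection from the pole with first coordinate [- s]: for [s = 1] or [-1]
    it carries the closed unit ball onto the hemisphere around the opposite pole. *)
Definition stereo {R : realType} {m} (s : R) (x : 'rV[R]_m) : 'rV[R]_m.+1 :=
  (1 + sqnorm x)^-1 *: consr (s * (1 - sqnorm x)) (2 *: x).
(** The absolute value projects each point from the pole of the other hemisphere. One continuous
    formula thus inverts both charts, and its values stay in the unit ball. *)
Definition unstereo {R : realType} {m} (y : 'rV[R]_m.+1) : 'rV[R]_m :=
  (1 + `|y 0 0|)^-1 *: tailr y.

Section stereo.
Context {R : realType} {m : nat}.
Implicit Types (s : R) (x : 'rV[R]_m) (y : 'rV[R]_m.+1).

Lemma sphereE k (z : 'rV[R]_k.+1) : sphere R k z <-> sqnorm z = 1.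
Proof. by []. Qed.

Lemma stereo_sphere s x : s ^+ 2 = 1 -> sphere R m (stereo s x).
Proof.
move=> s1; apply/sphereE; rewrite /stereo sqnormZ sqnorm_consr sqnormZ exprMn s1.
have : 1 + sqnorm x != 0 by rewrite gt_eqF// ltr_wpDr// sqnorm_ge0.
by move: (sqnorm x) => q q0; rewrite exprVn; apply: (mulfI (expf_neq0 2 q0));
  rewrite mulVKf ?expf_neq0// mulr1; ring.
Qed.

Lemma sqnorm_unstereo y : sphere R m y ->
  sqnorm (unstereo y) = (1 - `|y 0 0|) / (1 + `|y 0 0|).
Proof.
move=> /sphereE; rewrite -{1}(consr_tailr y) sqnorm_consr => y1.
rewrite /unstereo sqnormZ (_ : sqnorm (tailr y) = 1 - `|y 0 0| ^+ 2); last first.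
  by rewrite real_normK ?num_real// -y1 addrAC subrr add0r.
have : 1 + `|y 0 0| != 0 by rewrite gt_eqF// ltr_wpDr.
move: `|_| => q q0; rewrite exprVn; apply: (mulfI (expf_neq0 2 q0)).
by rewrite mulVKf ?expf_neq0// expr2 -mulrA (mulrCA _ _ _^-1) divff// mulr1; ring.
Qed.

Lemma unstereoK s y : s ^+ 2 = 1 -> s * `|y 0 0| = y 0 0 -> sphere R m y ->
  stereo s (unstereo y) = y.
Proof.
move=> s1 sy Sy; rewrite /stereo sqnorm_unstereo// -[RHS]consr_tailr.
rewrite /unstereo -[in RHS]sy.
have : 1 + `|y 0 0| != 0 by rewrite gt_eqF// ltr_wpDr.
move: `|_| => q q0; have q1 : 1 + (1 - q) / (1 + q) = 2 / (1 + q).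
  by rewrite -{1}(divff q0) -mulrDl; congr (_ / _); ring.
have q2 : 1 - (1 - q) / (1 + q) = q * 2 / (1 + q).
  by rewrite -{1}(divff q0) -mulrBl; congr (_ / _); ring.
rewrite q1 q2; apply/rowP => j; rewrite mxE; case: (unliftP ord0 j) => [k|] ->.
  by rewrite !consrS !mxE; field; rewrite ?q0 ?pnatr_eq0.
by rewrite !consr0; field; rewrite q0.
Qed.

Lemma unstereo_box y : sphere R m y -> forall i, - 1 <= unstereo y 0 i <= 1.
Proof.
move=> Sy i; rewrite -ler_norml -sqrtr_sqr -(sqrtr1 R) ler_wsqrtr//.
apply: le_trans (sqnorm_coord _ i) _; rewrite sqnorm_unstereo//.
by rewrite ler_pdivrMr ?ltr_wpDr// mul1r lerD2l; have := normr_ge0 (y 0 0); lra.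
Qed.

Lemma stereo_equator s s' x : sqnorm x = 1 -> stereo s x = stereo s' x.
Proof. by move=> x1; rewrite /stereo x1 subrr !mulr0. Qed.

Lemma stereo_continuous s : continuous (stereo s : 'rV[R]_m -> _).
Proof.
apply/cont_onT; apply: cont_onZ.
  apply: cont_onV; first by move=> x _; rewrite gt_eqF// ltr_wpDr// sqnorm_ge0.
  by apply: cont_onD; [exact: cont_on_cst|exact/cont_on_sqnorm/cont_on_id].
apply: cont_on_consr.
  apply: cont_onM; first exact: cont_on_cst.
  apply: cont_onD; first exact: cont_on_cst.
  exact/cont_onN/cont_on_sqnorm/cont_on_id.
by apply: cont_onZ; [exact: cont_on_cst|exact: cont_on_id].
Qed.

Lemma unstereo_continuous : continuous (unstereo : 'rV[R]_m.+1 -> _).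
Proof.
apply/cont_onT; apply: cont_onZ; last exact/cont_on_tailr/cont_on_id.
apply: cont_onV; first by move=> x _; rewrite gt_eqF// ltr_wpDr.
apply: cont_onD; first exact: cont_on_cst.
exact/cont_on_norm/cont_on_coord/cont_on_id.
Qed.

End stereo.

(** * Cylinders over spheres *)

(** The degenerate case [t1 = t2] is a sphere, so the same lemmas serve a transition function on a
    sphere and the vector field on an end. *)
Definition cyl (R : realType) (t1 t2 : R) m : set (R * 'rV[R]_m.+1) :=
  [set z | t1 <= z.1 <= t2 /\ sphere R m z.2].

Section cyl.
Context {R : realType}.
Variables (t1 t2 : R).
Hypothesis t12 : t1 <= t2.

(** A cube instead of a ball, because arguments are built on boxes. It contains the unit ball; its
    corners are sent past the equator, which does no harm since the chart is defined everywhere. *)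
Definition cbox m : set 'rV[R]_m.+1 := box (consr t1 (const_mx (-1))) (consr t2 (const_mx 1)).
Definition cyl_chart {m} (s : R) (w : 'rV[R]_m.+1) : R * 'rV[R]_m.+1 := (w 0 0, stereo s (tailr w)).
Definition cyl_coord {m} (z : R * 'rV[R]_m.+1) : 'rV[R]_m.+1 := consr z.1 (unstereo z.2).

Lemma cyl_chart_continuous m s : continuous (@cyl_chart m s).
Proof.
apply/cont_onT/cont_on_pair; first exact/cont_on_coord/cont_on_id.
apply: continuous_cont_on; first exact: stereo_continuous.
exact/cont_on_tailr/cont_on_id.
Qed.

Lemma cyl_coord_continuous m : continuous (@cyl_coord m).
Proof.
apply/cont_onT/cont_on_consr; first exact/cont_on_fst/cont_on_id.
apply: continuous_cont_on; first exact: unstereo_continuous.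
exact/cont_on_snd/cont_on_id.
Qed.

Lemma cbox_consr m t (x : 'rV[R]_m) : t1 <= t <= t2 -> (forall i, - 1 <= x 0 i <= 1) ->
  cbox (consr t x).
Proof.
move=> tt xx j; case: (unliftP ord0 j) => [k|] ->; last by rewrite !consr0.
by rewrite !consrS !mxE.
Qed.

Lemma cyl_chart_cyl m s (w : 'rV[R]_m.+1) : s ^+ 2 = 1 -> cbox w -> cyl t1 t2 (cyl_chart s w).
Proof.
move=> s1 bw; split; last exact: stereo_sphere.
by have := bw 0; rewrite !consr0.
Qed.

Lemma cyl_coord_cbox m (z : R * 'rV[R]_m.+1) : cyl t1 t2 z -> cbox (cyl_coord z).
Proof. by move=> [tz Sz]; apply: cbox_consr => //; exact: unstereo_box. Qed.

Lemma cyl_coordK m s (z : R * 'rV[R]_m.+1) : s ^+ 2 = 1 -> cyl t1 t2 z ->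
  s * `|z.2 0 0| = z.2 0 0 -> cyl_chart s (cyl_coord z) = z.
Proof.
move=> s1 [tz Sz] sz; rewrite /cyl_chart /cyl_coord consr0 consrK unstereoK//.
by case: z {tz Sz sz}.
Qed.

Lemma equator_cbox m t (x : 'rV[R]_m) : t1 <= t <= t2 -> sqnorm x = 1 -> cbox (consr t x).
Proof.
move=> tt x1; apply: cbox_consr => // i.
by rewrite -ler_norml -sqrtr_sqr -(sqrtr1 R) ler_wsqrtr// -x1 sqnorm_coord.
Qed.

Lemma cyl_chart_equator m t s s' (x : 'rV[R]_m) : sqnorm x = 1 ->
  cyl_chart s (consr t x) = cyl_chart s' (consr t x).
Proof. by move=> x1; rewrite /cyl_chart !consr0 !consrK (stereo_equator s s' x1). Qed.

Lemma sqnorm_delta m (i : 'I_m) : sqnorm (delta_mx 0 i : 'rV[R]_m) = 1.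
Proof.
rewrite /sqnorm (bigD1 i)//= big1 ?addr0; first by rewrite mxE !eqxx expr1n.
by move=> j /negbTE ji; rewrite mxE ji andbF expr0n.
Qed.

Lemma sqr1 : 1 ^+ 2 = 1 :> R. Proof. exact: expr1n. Qed.
Lemma sqrN1 : (-1) ^+ 2 = 1 :> R. Proof. by rewrite sqrrN expr1n. Qed.

Lemma cyl_connected m : connected (@cyl R t1 t2 m.+1).
Proof.
have -> : @cyl R t1 t2 m.+1 = cyl_chart 1 @` @cbox m.+1 `|` cyl_chart (-1) @` @cbox m.+1.
  apply/seteqP; split => [z cz|z [] [w bw <-]]; last 2 first.
  - by apply: cyl_chart_cyl => //; exact: sqr1.
  - by apply: cyl_chart_cyl => //; exact: sqrN1.
  have [z0|z0] := leP 0 (z.2 0 0).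
    left; exists (cyl_coord z); first exact: cyl_coord_cbox.
    by apply: cyl_coordK => //; rewrite ?sqr1// mul1r ger0_norm.
  right; exists (cyl_coord z); first exact: cyl_coord_cbox.
  by apply: cyl_coordK => //; rewrite ?sqrN1// mulN1r ltr0_norm// opprK.
apply: connectedU.
- exists (cyl_chart 1 (consr t1 (delta_mx 0 0))); split.
    exists (consr t1 (delta_mx 0 0)) => //; apply: equator_cbox; rewrite ?lexx//.
    exact: sqnorm_delta.
  rewrite (cyl_chart_equator _ _ (-1)) ?sqnorm_delta//.
  exists (consr t1 (delta_mx 0 0)) => //; apply: equator_cbox; rewrite ?lexx//.
  exact: sqnorm_delta.
- by apply: connected_image; [exact: box_connected|exact/cont_on_continuous/cyl_chart_continuous].
- by apply: connected_image; [exact: box_connected|exact/cont_on_continuous/cyl_chart_continuous].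
Qed.

(** This is where simple connectivity of [S^(m+2)] is used. Each hemisphere chart is a box and
    carries an argument; the two differ over the equator [S^(m+1)] by a multiple of [2 pi], which is
    constant because an equator of dimension at least 1 is connected. *)
Lemma cyl_arg m (u v : R * 'rV[R]_m.+3 -> R) :
  cont_on (@cyl R t1 t2 m.+2) u -> cont_on (@cyl R t1 t2 m.+2) v ->
  (forall z, @cyl R t1 t2 m.+2 z -> u z ^+ 2 + v z ^+ 2 != 0) ->
  exists th, cont_on (@cyl R t1 t2 m.+2) th /\
    forall z, @cyl R t1 t2 m.+2 z -> is_arg (u z) (v z) (th z).
Proof.
move=> cu cv uv.
have half s : s ^+ 2 = 1 -> exists th, cont_on (@cbox m.+2) th /\
    forall w, @cbox m.+2 w -> is_arg (u (cyl_chart s w)) (v (cyl_chart s w)) (th w).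
  move=> s1; apply: box_arg.
  - by apply: (cont_on_comp _ cu) => [|w]; [exact/cont_on_continuous/cyl_chart_continuous|exact: cyl_chart_cyl].
  - by apply: (cont_on_comp _ cv) => [|w]; [exact/cont_on_continuous/cyl_chart_continuous|exact: cyl_chart_cyl].
  - by move=> w bw; apply: uv; exact: cyl_chart_cyl.
  - move=> j; case: (unliftP ord0 j) => [k|] ->; last by rewrite !consr0.
    by rewrite !consrS !mxE; lra.
have [thp [cp hp]] := half 1 sqr1; have [thm [cm hm]] := half (-1) sqrN1.
pose d (z : R * 'rV[R]_m.+2) := thp (consr z.1 z.2) - thm (consr z.1 z.2).
have eqb z : @cyl R t1 t2 m.+1 z -> cbox (consr z.1 z.2).
  by move=> [tz /sphereE Sz]; exact: equator_cbox.
have cc : cont_on (@cyl R t1 t2 m.+1) (fun z => consr z.1 z.2).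
  by apply: cont_on_consr; [exact/cont_on_fst/cont_on_id|exact/cont_on_snd/cont_on_id].
have cd : cont_on (@cyl R t1 t2 m.+1) d.
  by apply: cont_onD; [|apply: cont_onN]; [exact: cont_on_comp cc cp eqb|exact: cont_on_comp cc cm eqb].
have d1 z : @cyl R t1 t2 m.+1 z -> cos (d z) = 1.
  move=> cz; have := hm _ (eqb z cz); rewrite (cyl_chart_equator _ _ 1); last by case: cz.
  by move=> hmz; exact: is_arg_cosB (hp _ (eqb z cz)) hmz.
pose z0 : R * 'rV[R]_m.+2 := (t1, delta_mx 0 0).
have z0c : @cyl R t1 t2 m.+1 z0 by split; [rewrite lexx|exact/sphereE/sqnorm_delta].
have dk z : @cyl R t1 t2 m.+1 z -> d z = d z0.
  by move=> cz; exact: connected_cos1_cst (@cyl_connected m) cd d1 _ _ cz z0c.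
pose th (z : R * 'rV[R]_m.+3) := if 0 <= z.2 0 0 then thp (cyl_coord z) else thm (cyl_coord z) + d z0.
have h0 : continuous (fun z : R * 'rV[R]_m.+3 => z.2 0 0).
  exact/cont_onT/cont_on_coord/cont_on_snd/cont_on_id.
exists th; split.
  pose thp' (z : R * 'rV[R]_m.+3) : R := thp (cyl_coord z).
  pose thm' (z : R * 'rV[R]_m.+3) : R := thm (cyl_coord z) + d z0.
  apply: (cont_on_paste (A := [set z : R * 'rV[R]_m.+3 | 0 <= z.2 0 0])
    (B := [set z : R * 'rV[R]_m.+3 | z.2 0 0 <= 0]) (f := thp') (g := thm')).
  - by apply: (@closed_comp _ _ (fun z : R * 'rV[R]_m.+3 => z.2 0 0) [set t | 0 <= t]) => [x _|];
      [exact: h0|exact: closed_ge].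
  - by apply: (@closed_comp _ _ (fun z : R * 'rV[R]_m.+3 => z.2 0 0) [set t | t <= 0]) => [x _|];
      [exact: h0|exact: closed_le].
  - by move=> z _; case: (leP 0 (z.2 0 0)) => [|/ltW] ?; [left|right].
  - apply: (cont_on_comp (cont_on_continuous _) cp); first exact: cyl_coord_continuous.
    by move=> z [cz _]; exact: cyl_coord_cbox.
  - apply: cont_onD; last exact: cont_on_cst.
    apply: (cont_on_comp (cont_on_continuous _) cm); first exact: cyl_coord_continuous.
    by move=> z [cz _]; exact: cyl_coord_cbox.
  - by move=> z _ /= z0'; rewrite /th z0'.
  - move=> z [tz Sz] /= zle; rewrite /th; case: leP => // zge.
    have z00 : z.2 0 0 = 0 by apply/le_anti/andP.
    have cz' : @cyl R t1 t2 m.+1 (z.1, unstereo z.2).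
      by split => //=; apply/sphereE; rewrite sqnorm_unstereo// z00 normr0 subr0 addr0 divr1.
    by rewrite /thm' -(dk _ cz') /d /cyl_coord /= addrC subrK.
move=> z cz; rewrite /th; case: leP => z0'.
  have := hp _ (cyl_coord_cbox cz); rewrite cyl_coordK//; first exact: sqr1.
  by rewrite mul1r ger0_norm.
have := hm _ (cyl_coord_cbox cz); rewrite cyl_coordK//.
- by move=> h; apply: is_argD => //; exact: d1.
- exact: sqrN1.
- by rewrite mulN1r ltr0_norm// opprK.
Qed.

End cyl.

(** * Trivialization of vector bundles *)

(** None of [G i], [F1], [F2] is assumed continuous by itself. Writing the quotient as the inverse
    of [G j x *m F2 x] times [G j x *m F1 x] cancels the arbitrary reference chart hidden in
    [G j]. *)
Lemma transition_cont (R : realType) (T : topologicalType) (C : set T) r (I : Type)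
    (V : I -> set T) (G : I -> T -> 'M[R]_r) (F1 F2 : T -> 'M[R]_r) :
  (forall i, open (V i)) -> (forall x, C x -> exists i, V i x) ->
  (forall i x, C x -> V i x -> G i x \in unitmx) -> (forall x, C x -> F2 x \in unitmx) ->
  (forall i, cont_on (C `&` V i) (fun x => G i x *m F1 x)) ->
  (forall i, cont_on (C `&` V i) (fun x => G i x *m F2 x)) ->
  cont_on C (fun x => invmx (F2 x) *m F1 x).
Proof.
move=> oV covV uG u2 c1 c2; apply: cont_on_local => x Cx.
have [j Vx] := covV x Cx; exists (V j); split => //.
apply: (@cont_on_eq _ _ _ (fun y => invmx (G j y *m F2 y) *m (G j y *m F1 y))).
  move=> y; rewrite inE => -[Cy Vy].
  have uGy := uG _ _ Cy Vy; have u2y := u2 y Cy.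
  apply: (canLR (mulKmx _)); first by rewrite unitmx_mul uGy.
  by rewrite -mulmxA (mulmxA (F2 y)) mulmxV// mul1mx.
apply: cont_on_mulmx; last exact: c1.
apply: cont_on_invmx => [y [Cy Vy]|]; last exact: c2.
by rewrite unitmx_mul uG//= u2.
Qed.

(* A bundle with charts [V i] is given by maps [G i x] from chart [i] to a reference chart chosen
   arbitrarily at each point [x]: only the quotients [G i x *m invmx (G j x)] are continuous, and
   a trivialization is a correction [F] making every [G i x *m F x] continuous. *)
Section box_trivial.
Context {R : realType} {m r : nat} {I : Type}.
Variables (V : I -> set 'rV[R]_m) (G : I -> 'rV[R]_m -> 'M[R]_r).
Hypothesis oV : forall i, open (V i).
Hypothesis uG : forall i x, V i x -> G i x \in unitmx.
Hypothesis cG : forall i j, cont_on (V i `&` V j) (fun x => G i x *m invmx (G j x)).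

Lemma box_trivial a b : (forall x, box a b x -> exists i, V i x) ->
  (forall i, a 0 i <= b 0 i) ->
  exists F : 'rV[R]_m -> 'M[R]_r, (forall x, box a b x -> F x \in unitmx) /\
    forall i, cont_on (box a b `&` V i) (fun x => G i x *m F x).
Proof.
move=> covV ab.
pose P a' b' := box a' b' `<=` box a b ->
  exists F : 'rV[R]_m -> 'M[R]_r, (forall x, box a' b' x -> F x \in unitmx) /\
    forall i, cont_on (box a' b' `&` V i) (fun x => G i x *m F x).
suff : P a b by exact.
apply: box_ind => //.
  move=> x bx; have [i0 Vx] := covV x bx.
  have /nbhs_ballP[e e0 eV] : nbhs x (V i0) by exact: open_nbhs_nbhs.
  (* Inside a single chart [i0] the correction [invmx (G i0 y)] works, by the very hypothesis
     [cG]. *)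
  exists e => // a' b' bsub _; exists (fun y => invmx (G i0 y)); split.
    by move=> y /bsub/eV /uG; rewrite unitmx_inv.
  move=> i; apply: cont_on_sub (cG (i := i) (j := i0)) => y [by_ Vy].
  by split => //; exact/eV/bsub.
move=> a' b' i c ab' aci IH1 IH2 sub.
have [F1 [u1 c1]] := IH1 (subset_trans (box_updl aci) sub).
have [F2 [u2 c2]] := IH2 (subset_trans (box_updr aci) sub).
pose A x := invmx (F2 x) *m F1 x.
pose face := box (upd a' i c) (upd b' i c).
have cA : cont_on face A.
  apply: (@transition_cont _ _ _ _ _ V G) => //.
  - by move=> x /(box_face aci)[x1 _]; exact/covV/sub/(box_updl aci).
  - by move=> k x _; exact: uG.
  - by move=> x /(box_face aci)[_]; exact: u2.
  - by move=> k; apply: cont_on_sub (c1 k) => x [/(box_face aci)[x1 _]].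
  - by move=> k; apply: cont_on_sub (c2 k) => x [/(box_face aci)[_ x2]].
(* The mismatch [A] of the two trivializations lives on the face only; precomposing with the
   projection along coordinate [i] extends it to the second half. *)
pose proj (x : 'rV[R]_m) := upd x i c.
have cproj : continuous proj.
  apply/cont_onT/cont_on_mx => k j; rewrite ord1.
  have [->|ji] := eqVneq j i.
    rewrite (_ : (fun z => _) = (fun=> c)); first exact: cont_on_cst.
    by apply/funext => z; rewrite updE eqxx.
  rewrite (_ : (fun z => _) = (fun z : 'rV[R]_m => z 0 j)); first exact/cont_on_coord/cont_on_id.
  by apply/funext => z; rewrite updE (negbTE ji).
have projf x : box (upd a' i c) b' x -> face (proj x).
  move=> bx j; rewrite !updE; case: eqP => [_|/eqP/negbTE ji]; first by rewrite lexx.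
  by have := bx j; rewrite updE ji.
have projid (x : 'rV[R]_m) : x 0 i = c -> proj x = x.
  by move=> xc; apply/rowP => j; rewrite updE; case: eqP => // ->.
have uA x : face x -> A x \in unitmx.
  by move=> /(box_face aci)[x1 x2]; rewrite unitmx_mul unitmx_inv u1// u2.
pose F (x : 'rV[R]_m) := if x 0 i <= c then F1 x else F2 x *m A (proj x).
exists F; split.
  move=> x bx; rewrite /F; case: leP => xc; first exact/u1/in_box_updl.
  have bx' : box (upd a' i c) b' x by apply: in_box_updr => //; exact: ltW.
  by rewrite unitmx_mul u2//= uA//; exact: projf.
move=> k; pose f1 x := G k x *m F1 x; pose f2 (x : 'rV[R]_m) := G k x *m F2 x *m A (proj x).
apply: (cont_on_paste (A := [set x : 'rV[R]_m | x 0 i <= c])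
    (B := [set x : 'rV[R]_m | c <= x 0 i]) (f := f1) (g := f2)).
- exact: coord_le_closed.
- exact: coord_ge_closed.
- by move=> x _ /=; case: (leP (x 0 i) c) => [|/ltW] ?; [left|right].
- by apply: cont_on_sub (c1 k) => x [[bx Vx] xc]; split => //; exact: in_box_updl.
- apply: cont_on_mulmx.
    by apply: cont_on_sub (c2 k) => x [[bx Vx] xc]; split => //; exact: in_box_updr.
  apply: (cont_on_comp (cont_on_continuous _) cA) => // x [[bx _] xc].
  exact/projf/in_box_updr.
- by move=> x _ /= xc; rewrite /F xc.
- move=> x [bx Vx] /= xc; rewrite /F /f2; case: leP => xc'; last by rewrite mulmxA.
  have {}xc : x 0 i = c by apply/le_anti/andP.
  have fx : face x := box_face_eq bx xc.
  by rewrite projid// /A -mulmxA mulKVmx// u2//; case: (box_face aci fx).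
Qed.

End box_trivial.

(** * Rotations and extension of matrix-valued maps from the sphere to the ball *)

Definition mx2 {R : realType} (a b c d : R) : 'M[R]_2 :=
  \matrix_(i, j) if i == 0 then (if j == 0 then a else b) else (if j == 0 then c else d).

Section rotation.
Context {R : realType}.

Lemma det2 (M : 'M[R]_2) : \det M = M 0 0 * M 1 1 - M 0 1 * M 1 0.
Proof.
rewrite (expand_det_row _ 0) big_ord_recl big_ord1 /cofactor !det_mx11 !mxE /=.
rewrite expr0 mul1r expr1 mulN1r mulrN.
by congr (_ * M _ _ - M _ _ * M _ _); apply/val_inj.
Qed.

Lemma cont_on_mx2 (T : topologicalType) (A : set T) (a b c d : T -> R) :
  cont_on A a -> cont_on A b -> cont_on A c -> cont_on A d ->
  cont_on A (fun x => mx2 (a x) (b x) (c x) (d x)).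
Proof.
move=> ca cb cc cd; apply: cont_on_mx => i j.
by have [i0|i0] := eqVneq i 0; have [j0|j0] := eqVneq j 0;
  [rewrite (_ : (fun x => _) = a)|rewrite (_ : (fun x => _) = b)|
   rewrite (_ : (fun x => _) = c)|rewrite (_ : (fun x => _) = d)] => //;
  apply/funext => x; rewrite mxE ?i0 ?j0 ?(negbTE i0) ?(negbTE j0).
Qed.

(** The sign convention is that of row vectors: right multiplication by [rot2 t] sends [(1, 0)] to
    [(cos t, sin t)]. *)
Definition rot2 (t : R) : 'M[R]_2 := mx2 (cos t) (sin t) (- sin t) (cos t).

Lemma det_rot t : \det (rot2 t) = 1.
Proof. by rewrite det2 !mxE /= mulrN opprK -!expr2 cos2Dsin2. Qed.

Lemma cont_on_rot (T : topologicalType) (A : set T) (f : T -> R) :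
  cont_on A f -> cont_on A (fun x => rot2 (f x)).
Proof.
move=> cf; apply: cont_on_mx2; by [exact: cont_on_cos|exact: cont_on_sin|
  exact/cont_onN/cont_on_sin].
Qed.

Lemma rot2_0 : rot2 0 = 1%:M.
Proof.
apply/matrixP => i j; rewrite !mxE cos0 sin0 oppr0.
by case: i => [[|[|?]] ?] //; case: j => [[|[|?]] ?].
Qed.

Lemma rot2NK t : rot2 (- t) *m rot2 t = 1%:M.
Proof.
have h := cos2Dsin2 t.
apply/matrixP => i j; rewrite !mxE big_ord_recl big_ord1 !mxE cosN sinN /=.
by case: i => [[|[|?]] ?] //; case: j => [[|[|?]] ?] //=; rewrite -?h; ring.
Qed.

End rotation.

Section extend.
Context {R : realType} {k : nat}.

Definition ball1 : set 'rV[R]_k.+3 := [set x | sqnorm x <= 1].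

Lemma sphere_normalize m (x : 'rV[R]_m.+1) : 0 < sqnorm x ->
  sphere R m ((Num.sqrt (sqnorm x))^-1 *: x).
Proof.
move=> x0; apply/sphereE; rewrite sqnormZ exprVn sqr_sqrtr ?(ltW x0)//.
by rewrite mulVf// gt_eqF.
Qed.

Lemma cont_on_normalize m : cont_on [set x : 'rV[R]_m.+1 | 0 < sqnorm x]
  (fun x => (Num.sqrt (sqnorm x))^-1 *: x).
Proof.
apply: cont_onZ; last exact: cont_on_id.
apply: cont_onV; first by move=> x /= x0; rewrite gt_eqF// sqrtr_gt0.
exact/cont_on_sqrt/cont_on_sqnorm/cont_on_id.
Qed.

Lemma open_sqnorm_lt m c : open [set x : 'rV[R]_m | sqnorm x < c].
Proof.
apply: (@open_comp _ _ (fun x : 'rV[R]_m => sqnorm x) [set t | t < c]); last exact: open_lt.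
by move=> x _; move: x; apply/cont_onT/cont_on_sqnorm/cont_on_id.
Qed.

Lemma open_sqnorm_gt m c : open [set x : 'rV[R]_m | c < sqnorm x].
Proof.
apply: (@open_comp _ _ (fun x : 'rV[R]_m => sqnorm x) [set t | c < t]); last exact: open_gt.
by move=> x _; move: x; apply/cont_onT/cont_on_sqnorm/cont_on_id.
Qed.

(* [A = L *m rot2 th] with [L] lower triangular with positive diagonal: [th] is scaled to [0]
   and [L] is joined to [1] by a segment, both along radii. *)
Lemma extend_GL2 (A : 'rV[R]_k.+3 -> 'M[R]_2) :
  cont_on (sphere R k.+2) A -> (forall x, sphere R k.+2 x -> 0 < \det (A x)) ->
  exists B : 'rV[R]_k.+3 -> 'M[R]_2, [/\ cont_on ball1 B, (forall x, ball1 x -> B x \in unitmx) &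
    (forall x, sphere R k.+2 x -> B x = A x)].
Proof.
move=> cA dA.
have inS (z : R * 'rV[R]_k.+3) : cyl 0 0 z -> sphere R k.+2 z.2 by case.
have cA2 : cont_on (@cyl R 0 0 k.+2) (fun z => A z.2).
  by apply: (cont_on_comp _ cA) => //; exact/cont_on_snd/cont_on_id.
have [th0 [cth0 hth0]] : exists th, cont_on (@cyl R 0 0 k.+2) th /\
    forall z, cyl 0 0 z -> is_arg (A z.2 0 0) (A z.2 0 1) (th z).
  apply: (cyl_arg (lexx 0)); try exact: cont_on_coord.
  (* The angle is that of the first row of [A], which cannot vanish because the determinant is
     positive. *)
  move=> z /inS/dA; rewrite det2; apply: contraTneq.
  move=> /eqP; rewrite paddr_eq0 ?sqr_ge0// !sqrf_eq0 => /andP[/eqP -> /eqP ->].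
  by rewrite !mul0r subr0 ltxx.
pose th (x : 'rV[R]_k.+3) : R := th0 (0, x).
have cyl0 x : sphere R k.+2 x -> cyl 0 0 (0 : R, x) by split; rewrite ?lexx.
have cth : cont_on (sphere R k.+2) th.
  apply: (cont_on_comp _ cth0); last exact: cyl0.
  by apply: cont_on_pair; [exact: cont_on_cst|exact: cont_on_id].
have hth x : sphere R k.+2 x -> is_arg (A x 0 0) (A x 0 1) (th x).
  by move=> /cyl0/hth0.
pose L (x : 'rV[R]_k.+3) : 'M[R]_2 := A x *m rot2 (- th x).
have cL : cont_on (sphere R k.+2) L.
  by apply: cont_on_mulmx => //; exact/cont_on_rot/cont_onN.
have L_tri x : sphere R k.+2 x -> [/\ L x 0 1 = 0, 0 < L x 0 0 & 0 < L x 1 1].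
  move=> Sx; have [r r0 [e0 e1]] := hth x Sx.
  have L01 : L x 0 1 = 0.
    rewrite /L !mxE big_ord_recl big_ord1 !mxE /= (_ : lift ord0 ord0 = 1); last exact/val_inj.
    by rewrite e0 e1 sinN cosN; ring.
  have L00 : L x 0 0 = r.
    rewrite /L !mxE big_ord_recl big_ord1 !mxE /= (_ : lift ord0 ord0 = 1); last exact/val_inj.
    rewrite e0 e1 sinN cosN opprK.
    by rewrite -[RHS]mulr1 -(cos2Dsin2 (th x)); ring.
  split => //; first by rewrite L00.
  have : 0 < \det (L x) by rewrite det_mulmx det_rot mulr1 dA.
  by rewrite det2 L01 mul0r subr0 L00 pmulr_rgt0.
(* The cut-off vanishes for [sqnorm x <= 1 / 2], making [B] the identity around the origin, where
   the radial projection [nrm] is not continuous; on the unit sphere it is 1. *)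
pose lam (x : 'rV[R]_k.+3) := Num.max 0 (2 * sqnorm x - 1).
pose nrm (x : 'rV[R]_k.+3) := (Num.sqrt (sqnorm x))^-1 *: x.
pose M (x : 'rV[R]_k.+3) := (1 - lam x) *: 1%:M + lam x *: L (nrm x).
pose B (x : 'rV[R]_k.+3) := M x *m rot2 (lam x * th (nrm x)).
have lam0 (x : 'rV[R]_k.+3) : sqnorm x < 1 / 2 -> lam x = 0.
  by move=> x2; rewrite /lam max_l//; lra.
have lam1 (x : 'rV[R]_k.+3) : sqnorm x = 1 -> lam x = 1.
  by move=> x1; rewrite /lam x1 max_r; lra.
have B0 (x : 'rV[R]_k.+3) : sqnorm x < 1 / 2 -> B x = 1%:M.
  move=> /lam0 l0; rewrite /B /M l0 mul0r rot2_0 subr0 scale1r scale0r addr0.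
  by rewrite mulmx1.
have clam : continuous lam.
  apply/cont_onT; have -> : lam = fun x => ((2 * sqnorm x - 1) + `|2 * sqnorm x - 1|) / 2.
    apply/funext => x; rewrite /lam; set t := 2 * _ - 1.
    have [t0|t0] := leP 0 t; first by rewrite ger0_norm//; lra.
    by rewrite ltr0_norm//; lra.
  have ct : cont_on setT (fun x : 'rV[R]_k.+3 => 2 * sqnorm x - 1).
    apply: cont_onD; last exact: cont_on_cst.
    by apply: cont_onM; [exact: cont_on_cst|exact/cont_on_sqnorm/cont_on_id].
  by apply: cont_onM; [apply: cont_onD => //; exact: cont_on_norm|exact: cont_on_cst].
exists B; split.
- apply: cont_on_local => x bx; have [x2|x2] := ltP (sqnorm x) (1 / 2).
    exists [set x | sqnorm x < 1 / 2]; split => //; first exact: open_sqnorm_lt.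
    apply: (@cont_on_eq _ ('M[R]_2) _ (fun=> 1%:M)); last exact: cont_on_cst.
    by move=> y; rewrite inE => -[_ /B0].
  exists [set x | 0 < sqnorm x]; split; [exact: open_sqnorm_gt|by move=> /=; lra|].
  have cn : cont_on (ball1 `&` [set x | 0 < sqnorm x]) nrm.
    by apply: cont_on_sub (@cont_on_normalize k.+2) => y [].
  have nS y : (ball1 `&` [set x | 0 < sqnorm x]) y -> sphere R k.+2 (nrm y).
    by move=> [_]; exact: sphere_normalize.
  have cl : cont_on (ball1 `&` [set x | 0 < sqnorm x]) lam by exact: cont_on_continuous.
  apply: cont_on_mulmx; last first.
    by apply/cont_on_rot/cont_onM => //; exact: cont_on_comp cn cth nS.
  rewrite (_ : M = fun y => (1 - lam y)%:M + lam y *: L (nrm y)); last first.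
    by apply/funext => y; rewrite /M scalemx1.
  apply: cont_on_mx => i j.
  rewrite (_ : (fun y => _) = fun y => (1 - lam y) * (i == j)%:R + lam y * L (nrm y) i j); last first.
    by apply/funext => y; rewrite !mxE mulr_natr.
  apply: cont_onD; apply: cont_onM => //; try exact: cont_on_cst.
    by apply: cont_onD; [exact: cont_on_cst|exact: cont_onN].
  by apply: cont_on_coord; exact: cont_on_comp cn cL nS.
- move=> x bx; have [/B0 ->|x2] := ltP (sqnorm x) (1 / 2); first exact: unitmx1.
  rewrite unitmxE det_mulmx det_rot mulr1 unitfE gt_eqF// det2.
  have half0 : 0 < 1 / 2 :> R by lra.
  have [L01 L00 L11] := L_tri (nrm x) (sphere_normalize (lt_le_trans half0 x2)).
  have l0 : 0 <= lam x by rewrite /lam le_max lexx.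
  have l1 : lam x <= 1 by rewrite /lam ge_max ler01 /=; move: bx; rewrite /ball1 /= => ?; lra.
  have ME i j : M x i j = (1 - lam x) * (i == j)%:R + lam x * L (nrm x) i j.
    by rewrite !mxE mulr_natr.
  (* [M x] is still lower triangular, and its diagonal entries are convex combinations of 1 and a
     positive number. *)
  rewrite !ME L01 !eqxx !mulr0 addr0 mul0r subr0 !mulr1.
  by apply: mulr_gt0; nra.
- move=> x Sx; have x1 : sqnorm x = 1 by [].
  rewrite /B /M lam1// subrr scale0r add0r scale1r mul1r.
  have -> : nrm x = x by rewrite /nrm x1 sqrtr1 invr1 scale1r.
  by rewrite /L -mulmxA rot2NK mulmx1.
Qed.

End extend.

Lemma sphere_connected (R : realType) m : connected (sphere R m.+1).
Proof.
rewrite (_ : sphere R m.+1 = snd @` @cyl R 0 0 m.+1).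
  apply: connected_image; first exact/cyl_connected.
  exact/cont_on_snd/cont_on_id.
apply/seteqP; split => [x Sx|_ [z [_ Sz] <-]] //.
by exists (0, x) => //; split; rewrite ?lexx.
Qed.

Section sphere_trivial.
Context {R : realType} {k : nat} {I : Type}.
Local Notation S := (sphere R k.+3).
Variables (U : I -> set 'rV[R]_k.+4) (G : I -> 'rV[R]_k.+4 -> 'M[R]_2).
Hypothesis oU : forall i, exists O, open O /\ U i = S `&` O.
Hypothesis covU : forall b, S b -> exists i, U i b.
Hypothesis uG : forall i b, U i b -> G i b \in unitmx.
Hypothesis cG : forall i j, cont_on (U i `&` U j) (fun x => G i x *m invmx (G j x)).

Lemma sphere_trivial : exists F : 'rV[R]_k.+4 -> 'M[R]_2,
  (forall b, S b -> F b \in unitmx) /\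
  forall i, cont_on (U i) (fun b => G i b *m F b).
Proof.
pose Q := box (const_mx (-1)) (const_mx 1) : set 'rV[R]_k.+3.
pose V s i := [set x : 'rV[R]_k.+3 | U i (stereo s x)].
have oV s i : s ^+ 2 = 1 -> open (V s i).
  move=> s1; have [ O [oO UO]] := oU i.
  rewrite (_ : V s i = stereo s @^-1` O).
    by apply: open_comp => // x _; exact: stereo_continuous.
  rewrite /V UO; apply/seteqP; split => x /=; first by case.
  by split => //; exact: stereo_sphere.
have half s : s ^+ 2 = 1 -> exists F : 'rV[R]_k.+3 -> 'M[R]_2,
    (forall x, Q x -> F x \in unitmx) /\
    forall i, cont_on (Q `&` V s i) (fun x => G i (stereo s x) *m F x).
  move=> s1; apply: (@box_trivial _ _ _ _ (V s) (fun i x => G i (stereo s x))).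
  - by move=> i; exact: oV.
  - by move=> i x Vx; exact: uG.
  - move=> i j; apply: (cont_on_comp _ (cG (i:=i) (j:=j))) => //.
    exact/cont_on_continuous/stereo_continuous.
  - by move=> x _; apply/covU/stereo_sphere.
  - by move=> i; rewrite !mxE; lra.
have [Fp [up cp]] := half 1 sqr1; have [Fm [um cm]] := half (-1) sqrN1.
have SQ x : sphere R k.+2 x -> Q x.
  move=> Sx i; rewrite !mxE -ler_norml -sqrtr_sqr -(sqrtr1 R) ler_wsqrtr//.
  by rewrite -(_ : sqnorm x = 1)// sqnorm_coord.
pose A (x : 'rV[R]_k.+3) : 'M[R]_2 := invmx (Fm x) *m Fp x.
have cA : cont_on (sphere R k.+2) A.
  apply: (@transition_cont _ _ _ _ _ (V 1) (fun i x => G i (stereo 1 x))).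
  - by move=> i; exact/oV/sqr1.
  - by move=> x _; apply/covU/stereo_sphere/sqr1.
  - by move=> i x _; exact: uG.
  - by move=> x /SQ; exact: um.
  - by move=> i; apply: cont_on_sub (cp i) => x [/SQ].
  - move=> i; apply: (@cont_on_eq _ _ _ (fun x => G i (stereo (-1) x) *m Fm x)).
      by move=> x; rewrite inE => -[Sx _]; rewrite (stereo_equator 1 (-1) Sx).
    apply: cont_on_sub (cm i) => x [Sx Vx]; split; first exact: SQ.
    by rewrite /V /= (stereo_equator (-1) 1 Sx).
have dA0 x : sphere R k.+2 x -> \det (A x) != 0.
  by move=> Sx; rewrite -unitfE -unitmxE unitmx_mul unitmx_inv um ?up//; exact: SQ.
have Sconn : connected (sphere R k.+2) by exact: sphere_connected.
(* The transition function may reverse orientation, but with a constant sign [s]; multiplying by the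
   reflection [D] of determinant [s] makes [extend_GL2] applicable, and a second factor [D] removes
   it afterwards. *)
have [s [s1 ds]] : exists s : R, s ^+ 2 = 1 /\ forall x, sphere R k.+2 x -> 0 < s * \det (A x).
  pose x0 : 'rV[R]_k.+3 := delta_mx 0 0.
  have Sx0 : sphere R k.+2 x0 by apply/sphereE; exact: sqnorm_delta.
  have := dA0 x0 Sx0; rewrite neq_lt => /orP[d0|d0].
    exists (-1); split; first exact: sqrN1.
    move=> x Sx; rewrite mulN1r oppr_gt0.
    exact: (connected_neg Sconn (cont_on_det cA) dA0 Sx0 d0).
  exists 1; split; first exact: sqr1.
  move=> x Sx; rewrite mul1r.
  exact: (connected_pos Sconn (cont_on_det cA) dA0 Sx0 d0).
pose D : 'M[R]_2 := mx2 s 0 0 1.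
have dD : \det D = s by rewrite det2 !mxE /= mulr1 mulr0 subr0.
have DD : D *m D = 1%:M.
  apply/matrixP => i j; rewrite !mxE big_ord_recl big_ord1 !mxE /=.
  by case: i => [[|[|?]] ?] //; case: j => [[|[|?]] ?] //=;
    rewrite ?mulr0 ?mul0r ?addr0 ?add0r ?mulr1// -expr2 s1.
have [|x Sx|B [cB uB BA]] := @extend_GL2 R k (fun x => D *m A x).
- by apply: cont_on_mulmx => //; exact: cont_on_cst.
- by rewrite det_mulmx dD ds.
pose C (x : 'rV[R]_k.+3) : 'M[R]_2 := D *m B x.
have cC : cont_on ball1 C by apply: cont_on_mulmx => //; exact: cont_on_cst.
have uC x : ball1 x -> C x \in unitmx.
  move=> /uB uBx; rewrite unitmx_mul uBx andbT unitmxE unitfE dD.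
  by apply/eqP => s0; move: s1; rewrite s0 expr0n /= => /eqP; rewrite eq_sym oner_eq0.
have CA x : sphere R k.+2 x -> C x = A x.
  by move=> Sx; rewrite /C BA// mulmxA DD mul1mx.
have ub (b : 'rV[R]_k.+4) : S b -> Q (unstereo b).
  by move=> Sb i; have := unstereo_box Sb i; rewrite !mxE.
have ub1 (b : 'rV[R]_k.+4) : S b -> ball1 (unstereo b).
  move=> Sb; rewrite /ball1 /= sqnorm_unstereo// ler_pdivrMr ?ltr_wpDr//.
  by rewrite mul1r lerD2l; have := normr_ge0 (b 0 0); lra.
(* On the equator [C] equals [A = invmx Fm *m Fp], so [Fm *m C] agrees there with [Fp]. *)
pose F (b : 'rV[R]_k.+4) :=
  if 0 <= b 0 0 then Fp (unstereo b) else Fm (unstereo b) *m C (unstereo b).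
have US i b : U i b -> S b by have [ O [_ ->]] := oU i; case.
exists F; split.
  move=> b Sb; rewrite /F; case: leP => _; first exact/up/ub.
  by rewrite unitmx_mul um/= ?uC//; [exact: ub1|exact: ub].
move=> i.
pose f1 (b : 'rV[R]_k.+4) := G i (stereo 1 (unstereo b)) *m Fp (unstereo b).
pose f2 (b : 'rV[R]_k.+4) := G i (stereo (-1) (unstereo b)) *m Fm (unstereo b) *m C (unstereo b).
have stp (b : 'rV[R]_k.+4) : S b -> 0 <= b 0 0 -> stereo 1 (unstereo b) = b.
  by move=> Sb b0; rewrite unstereoK ?sqr1// mul1r ger0_norm.
have stm (b : 'rV[R]_k.+4) : S b -> b 0 0 <= 0 -> stereo (-1) (unstereo b) = b.
  by move=> Sb b0; rewrite unstereoK ?sqrN1// mulN1r ler0_norm// opprK.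
have cu A' : cont_on A' (unstereo : 'rV[R]_k.+4 -> _).
  exact/cont_on_continuous/unstereo_continuous.
apply: (cont_on_paste (A := [set b : 'rV[R]_k.+4 | 0 <= b 0 0])
    (B := [set b : 'rV[R]_k.+4 | b 0 0 <= 0]) (f := f1) (g := f2)).
- exact: coord_ge_closed.
- exact: coord_le_closed.
- by move=> b _; case: (leP 0 (b 0 0)) => [|/ltW] ?; [left|right].
- apply: (cont_on_comp (cu _) (cp i)) => b [Ub b0]; have Sb := US _ _ Ub.
  by split; [exact: ub|rewrite /V /= stp].
- apply: cont_on_mulmx.
    apply: (cont_on_comp (cu _) (cm i)) => b [Ub b0]; have Sb := US _ _ Ub.
    by split; [exact: ub|rewrite /V /= stm].
  by apply: (cont_on_comp (cu _) cC) => b [/US/ub1].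
- by move=> b /US Sb b0; rewrite /F /f1 stp// ifT.
- move=> b /US Sb /= b0; rewrite /F /f2 stm//; case: leP => b0'; last by rewrite mulmxA.
  have b00 : b 0 0 = 0 by apply/le_anti/andP.
  have Su : sphere R k.+2 (unstereo b).
    by apply/sphereE; rewrite sqnorm_unstereo// b00 normr0 subr0 addr0 divr1.
  by rewrite CA// /A -mulmxA mulKVmx// um//; exact: ub.
Qed.

End sphere_trivial.

Lemma mulmx_ext (R : realType) r (A B : 'M[R]_r) :
  (forall v : 'rV[R]_r, v *m A = v *m B) -> A = B.
Proof. by move=> AB; apply/row_matrixP => i; rewrite !rowE. Qed.

Lemma bundle_trivial (R : realType) k (E : topologicalType) (p : E -> 'rV[R]_k.+4) :
  rank_vector_bundle_over_sphere R k.+3 2 E p ->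
  exists (W : E -> 'rV[R]_2) (Psi : 'rV[R]_k.+4 * 'rV[R]_2 -> E),
    [/\ continuous W,
        cont_on [set z | sphere R k.+3 z.1] Psi,
        (forall b v, sphere R k.+3 b -> p (Psi (b, v)) = b /\ W (Psi (b, v)) = v) &
        (forall e, Psi (p e, W e) = e)].
Proof.
move=> [cp [pS [I [U [phi [psi [[oU covU US] [hom fib lin]]]]]]]].
have cphi i : cont_on (p @^-1` U i) (phi i).
  by apply/cont_onP; case: (hom i) => -[].
have cpsi i : cont_on [set z | U i z.1] (psi i).
  by apply/cont_onP; case: (hom i) => -[].
have Upsi i z : U i z.1 -> U i (p (psi i z)).
  by case: (hom i) => -[_ _ _ +] _; apply.
have phiK i e : U i (p e) -> psi i (phi i e) = e.
  by case: (hom i) => _ [+ _]; apply.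
have psiK i z : U i z.1 -> phi i (psi i z) = z.
  by case: (hom i) => _ [_]; apply.
have ppsi i b v : U i b -> p (psi i (b, v)) = b.
  by move=> Ub; rewrite -(fib i) ?psiK//; exact: Upsi.
have phiE i e : U i (p e) -> phi i e = (p e, (phi i e).2).
  by move=> Ue; rewrite -(fib i e Ue); case: (phi i e).
(* The matrices of [lin] exist pointwise only. Reading their rows off as images of the basis vectors
   makes them inherit continuity from the charts; invertibility will come from the cocycle identity
   [TT]. *)
pose T i j b : 'M[R]_2 := \matrix_(a, l) (phi j (psi i (b, delta_mx 0 a))).2 0 l.
have TE i j b v : U i b -> U j b -> phi j (psi i (b, v)) = (b, v *m T i j b).
  move=> Ui Uj; rewrite phiE ppsi//; congr (_, _).
  have [M HM] := lin i j b Ui Uj.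
  rewrite HM (_ : T i j b = M)//; apply/matrixP => a l; rewrite mxE HM.
  by rewrite -rowE mxE.
have TT i j l b : U i b -> U j b -> U l b -> T i j b *m T j l b = T i l b.
  move=> Ui Uj Ul; apply: mulmx_ext => v; rewrite mulmxA.
  have : phi l (psi i (b, v)) = phi l (psi j (b, v *m T i j b)).
    by rewrite -TE// phiK// ppsi.
  by rewrite !TE// => -[].
have T1 i b : U i b -> T i i b = 1%:M.
  move=> Ui; apply: mulmx_ext => v; rewrite mulmx1.
  by have := TE i i b v Ui Ui; rewrite psiK// => -[].
have [i0 _] : exists i, U i (delta_mx 0 0).
  by apply/covU/sphereE/sqnorm_delta.
(* A reference chart at every point, chosen without continuity; [i0] is a default value off the
   sphere. *)
have /choice[c cU] b : exists i, sphere R k.+3 b -> U i b.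
  have [/covU[i Ui]|nS] := pselect (sphere R k.+3 b); first by exists i.
  by exists i0.
pose G i b := T i (c b) b.
have uT i j b : U i b -> U j b -> T i j b \in unitmx.
  by move=> Ui Uj; have /mulmx1_unit[] : T i j b *m T j i b = 1%:M by rewrite TT// T1.
have cUb i b : U i b -> U (c b) b by move=> /US/cU.
have cT i j : cont_on (U i `&` U j) (T i j).
  apply: cont_on_mx => a l.
  rewrite (_ : (fun b => _) = fun b => (phi j (psi i (b, delta_mx 0 a))).2 0 l); last first.
    by apply/funext => b; rewrite mxE.
  apply/cont_on_coord/cont_on_snd.
  apply: (cont_on_comp _ (cphi j)) => [|b [Ui Uj]]; last by rewrite /preimage /= ppsi.
  apply: (cont_on_comp _ (cpsi i)) => [|b []//].
  by apply: cont_on_pair; [exact: cont_on_id|exact: cont_on_cst].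
have [|i j|F [uF cF]] := @sphere_trivial R k I U G oU covU.
- by move=> i b Ui; apply: uT => //; exact: cUb Ui.
- apply: (@cont_on_eq _ _ _ (T i j)); last exact: cT.
  move=> b; rewrite inE => -[Ui Uj]; apply/esym.
  have Uc := cUb _ _ Ui.
  by rewrite /G -(TT i j (c b))// mulmxK//; exact: uT.
(* The fibre coordinate in the reference chart, corrected by [F]. By [WE] any chart around [p e]
   computes the same value, with a matrix that is continuous in the base point; [PsiE] does the same
   for the inverse. *)
pose W e := (phi (c (p e)) e).2 *m F (p e).
pose Psi (z : 'rV[R]_k.+4 * 'rV[R]_2) := psi (c z.1) (z.1, z.2 *m invmx (F z.1)).
have WE i e : U i (p e) -> W e = (phi i e).2 *m (G i (p e) *m F (p e)).
  move=> Ui; rewrite /W mulmxA; congr (_ *m _).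
  rewrite -{2}(phiK i e Ui) (phiE i e Ui) TE//; exact: cUb Ui.
have PsiE i z : U i z.1 -> Psi z = psi i (z.1, z.2 *m invmx (G i z.1 *m F z.1)).
  case: z => b v /= Ui; have Uc := cUb _ _ Ui; have Sb := US _ _ Ui.
  rewrite /Psi /= -(phiK (c b) (psi i _)) ?ppsi//; congr psi; rewrite TE//; congr (_, _).
  rewrite -/(G i b) -mulmxA; congr (_ *m _).
  have uGF : G i b *m F b \in unitmx by rewrite unitmx_mul uF// andbT; exact: uT.
  by apply: (can_inj (mulKmx uGF)); rewrite mulKVmx// mulmxK// uF.
exists W, Psi; split.
- apply/cont_onT; apply: cont_on_local => e _; have [i Ui] := covU _ (pS e).
  have [ O [oO UO]] := oU i; exists (p @^-1` O); split.
  + by apply: open_comp => // x _; exact: cp.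
  + by move: Ui; rewrite UO => -[].
  rewrite setTI; apply: (@cont_on_eq _ _ _ (fun e => (phi i e).2 *m (G i (p e) *m F (p e)))).
    by move=> x; rewrite inE => Ox; rewrite (WE i)// UO.
  have sub : p @^-1` O `<=` p @^-1` U i by move=> x Ox; rewrite /preimage /= UO.
  apply: cont_on_mulmx; first exact/cont_on_snd/(cont_on_sub sub).
  by apply: (cont_on_comp _ (cF i)) => //; exact: cont_on_continuous.
- apply: cont_on_local => z Sz; have [i Ui] := covU _ Sz.
  have [ O [oO UO]] := oU i; exists (fst @^-1` O); split.
  + by apply: open_comp => // x _; exact: cvg_fst.
  + by move: Ui; rewrite UO => -[].
  pose v' (z : 'rV[R]_k.+4 * 'rV[R]_2) := (z.1, z.2 *m invmx (G i z.1 *m F z.1)).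
  pose Psi' z : E := psi i (v' z).
  apply: (cont_on_eq (f := Psi')).
    by move=> x; rewrite inE => -[Sx Ox]; rewrite (PsiE i)// UO.
  have sub x : ([set z | sphere R k.+3 z.1] `&` fst @^-1` O) x -> U i x.1.
    by move=> -[Sx Ox]; rewrite UO.
  apply: (cont_on_comp (f := v') _ (cpsi i)) => [|x /sub//].
  apply: (@cont_on_pair _ _ _ _ (fun z : 'rV[R]_k.+4 * 'rV[R]_2 => z.1)
    (fun z : 'rV[R]_k.+4 * 'rV[R]_2 => z.2 *m invmx (G i z.1 *m F z.1))).
    exact/cont_on_fst/cont_on_id.
  apply: cont_on_mulmx; first exact/cont_on_snd/cont_on_id.
  apply: cont_on_invmx.
    move=> x /sub Ux; rewrite unitmx_mul uF ?andbT; last exact: US Ux.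
    by apply: uT => //; exact: cUb Ux.
  apply: (cont_on_comp (f := fun z : 'rV[R]_k.+4 * 'rV[R]_2 => z.1) _ (cF i)) => [|x /sub//].
  exact/cont_on_fst/cont_on_id.
- move=> b v Sb; have [i Ui] := covU _ Sb; rewrite (PsiE i (b, v) Ui) /= ppsi//; split => //.
  rewrite (WE i) ppsi// psiK//= mulmxKV// unitmx_mul uF// andbT.
  by apply: uT => //; exact: cUb Ui.
- move=> e; have [i Ui] := covU _ (pS e); rewrite (PsiE i (p e, W e) Ui) /= (WE i)//.
  rewrite mulmxK -?phiE ?phiK// unitmx_mul uF// andbT.
  by apply: uT => //; exact: cUb Ui.
Qed.

(** * No open subset of the total space embeds in the plane *)

(** A field without zeros on the square has a continuous argument [th]. Oddness on the circle makes
    [d z = th (- z) - th z - pi] a multiple of [2 pi], hence constant; comparing [d] at two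
    antipodes gives [d = - pi], which is not such a multiple. *)
Lemma odd_circle (R : realType) (u v : 'rV[R]_2 -> R) :
  let Q := box (const_mx (-1)) (const_mx 1) in
  cont_on Q u -> cont_on Q v -> (forall z, Q z -> u z ^+ 2 + v z ^+ 2 != 0) ->
  (forall z, sphere R 1 z -> u (- z) = - u z /\ v (- z) = - v z) -> False.
Proof.
move=> Q cu cv uv odd.
have [|th [cth hth]] := box_arg cu cv uv; first by move=> i; rewrite !mxE; lra.
have SQ z : sphere R 1 z -> Q z.
  move=> Sz i; rewrite !mxE -ler_norml -sqrtr_sqr -(sqrtr1 R) ler_wsqrtr//.
  by rewrite -(_ : sqnorm z = 1)// sqnorm_coord.
have SN z : sphere R 1 z -> sphere R 1 (- z).
  by move=> Sz; apply/sphereE; rewrite -scaleN1r sqnormZ sqrN1 mul1r.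
pose d z := th (- z) - (th z + pi).
have cd : cont_on (sphere R 1) d.
  have cS : cont_on (sphere R 1) th by apply: cont_on_sub cth.
  apply: cont_onD; last by apply/cont_onN/cont_onD => //; exact: cont_on_cst.
  apply: (cont_on_comp _ cS) => //; apply: cont_on_continuous.
  exact: opp_continuous.
have d1 z : sphere R 1 z -> cos (d z) = 1.
  move=> Sz; apply: is_arg_cosB (hth _ (SQ _ (SN _ Sz))) _.
  have [r r0 [ur vr]] := hth _ (SQ _ Sz); have [-> ->] := odd _ Sz.
  by exists r => //; rewrite cosDpi sinDpi ur vr !mulrN.
have Sconn : connected (sphere R 1) by exact: sphere_connected.
pose x0 : 'rV[R]_2 := delta_mx 0 0.
have Sx0 : sphere R 1 x0 by apply/sphereE; exact: sqnorm_delta.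
have := connected_cos1_cst Sconn cd d1 Sx0 (SN _ Sx0).
rewrite /d opprK => e; have := d1 _ Sx0.
have -> : d x0 = - pi by rewrite /d; lra.
by rewrite cosN cospi; lra.
Qed.

(** An arc in the base together with the two fibre directions spans a three-dimensional slice of
    [O], and already a small ball in it cannot be injected into the plane. *)
Lemma no_plane_embedding (R : realType) k (E : topologicalType)
    (p : E -> 'rV[R]_k.+2) (W : E -> 'rV[R]_2) (Psi : 'rV[R]_k.+2 * 'rV[R]_2 -> E)
    (O : set E) (H : E -> R * R) b0 v0 :
  cont_on [set z | sphere R k.+1 z.1] Psi ->
  (forall b v, sphere R k.+1 b -> p (Psi (b, v)) = b /\ W (Psi (b, v)) = v) ->
  sphere R k.+1 b0 -> open O -> O (Psi (b0, v0)) -> cont_on O H ->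
  (forall e e', O e -> O e' -> H e = H e' -> e = e') -> False.
Proof.
move=> cPsi PsiK Sb0 oO Oe cH injH.
have [i bi] : exists i, b0 0 i != 0.
  case: (boolP [exists i, b0 0 i != 0]) => [/existsP//|/existsPn b00].
  have /sphereE := Sb0; rewrite /sqnorm big1; first by move/eqP; rewrite eq_sym oner_eq0.
  by move=> i _; have := b00 i; rewrite negbK => /eqP ->; rewrite expr0n.
have [j ji] : exists j, j != i.
  by exists (if i == 0 then 1 else 0); have [->|] := eqVneq i 0; rewrite // eq_sym.
(* The line moves coordinate [j] and keeps [b0 0 i], which is nonzero. It therefore misses the
   origin, and its radial projection [nB] is injective: the ratio of coordinates [j] and [i]
   recovers [t]. *)
pose B (t : R) : 'rV[R]_k.+2 := b0 + t *: delta_mx 0 j.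
have Bi t : B t 0 i = b0 0 i by rewrite !mxE eqxx eq_sym (negbTE ji) mulr0 addr0.
have Bj t : B t 0 j = b0 0 j + t by rewrite !mxE !eqxx mulr1.
have B_gt0 t : 0 < sqnorm (B t).
  apply: lt_le_trans (sqnorm_coord _ i); rewrite Bi.
  by rewrite lt_neqAle eq_sym sqrf_eq0 bi sqr_ge0.
pose nB t := (Num.sqrt (sqnorm (B t)))^-1 *: B t.
have SnB t : sphere R k.+1 (nB t) by exact: sphere_normalize.
have nB_inj t t' : nB t = nB t' -> t = t'.
  have nBE a l : nB a 0 l = (Num.sqrt (sqnorm (B a)))^-1 * B a 0 l by rewrite [LHS]mxE.
  move=> /rowP e; have := e i; have := e j; rewrite !nBE !Bi !Bj.
  move=> ej /(mulIf bi) ei; move: ej; rewrite ei => /mulfI.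
  by rewrite invr_eq0 gt_eqF ?sqrtr_gt0// => /(_ isT)/addrI.
pose q (w : 'rV[R]_3) := (nB (w 0 0), v0 + tailr w).
have cq : continuous q.
  apply/cont_onT; apply: (@cont_on_pair _ _ _ _ (fun w : 'rV[R]_3 => nB (w 0 0))
    (fun w : 'rV[R]_3 => v0 + tailr w)).
    pose Bw (w : 'rV[R]_3) := B (w 0 0).
    apply: (cont_on_comp (f := Bw) _ (@cont_on_normalize _ _)) => [|w _]; last exact: B_gt0.
    apply: cont_on_mx => a l; rewrite (_ : (fun w => _) =
        fun w : 'rV[R]_3 => b0 a l + w 0 0 * (delta_mx 0 j : 'rV[R]_k.+2) a l); last first.
      by apply/funext => w; rewrite !mxE.
    apply: cont_onD; first exact: cont_on_cst.
    by apply: cont_onM; [exact/cont_on_coord/cont_on_id|exact: cont_on_cst].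
  apply: cont_on_mx => a l; rewrite (_ : (fun w => _) =
      fun w : 'rV[R]_3 => v0 a l + tailr w a l); last first.
    by apply/funext => w; rewrite !mxE.
  apply: cont_onD; first exact: cont_on_cst.
  exact/cont_on_coord/cont_on_tailr/cont_on_id.
have cPq : cont_on setT (fun w => Psi (q w)).
  by apply: (cont_on_comp _ cPsi) => [|w _]; [exact/cont_on_continuous|exact: SnB].
have q0 : Psi (q 0) = Psi (b0, v0).
  rewrite /q /nB /B (_ : (0 : 'rV[R]_3) 0 0 = 0) ?mxE// scale0r addr0.
  rewrite (_ : sqnorm b0 = 1)// sqrtr1 invr1 scale1r; congr (Psi (_, _)).
  by apply/rowP => l; rewrite !mxE addr0.
pose N := [set w | O (Psi (q w))].
have oN : open N by have := open_preim cPq openT oO; rewrite setTI.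
have N0 : N 0 by rewrite /N /= q0.
have /nbhs_ballP[e e0 eN] : nbhs (0 : 'rV[R]_3) N by exact: open_nbhs_nbhs.
pose Q := box (const_mx (-1)) (const_mx 1) : set 'rV[R]_2.
pose tau (z : 'rV[R]_2) := 1 - sqnorm z.
(* [z |-> (tau z, z)] parametrizes a disc whose boundary circle is invariant under the antipode;
   it never meets its antipodal image, so [h 1 - h (-1)] has no zero but is odd on the circle. *)
pose L (s : R) (z : 'rV[R]_2) := (s * (e / 2)) *: consr (tau z) z.
have NL s z : `|s| = 1 -> Q z -> N (L s z).
  (* Balls are those of the sup norm. On the square [sqnorm z] is at most 2, so all three
     coordinates of [consr (tau z) z] are at most 1 in absolute value, and the factor [e / 2] makes
     the bound strict. *)
  move=> s1 Qz; apply: eN; split=> // a l; rewrite /ball /= !ord1 !mxE sub0r normrN.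
  have zb (x : 'I_2) : `|z 0 x| <= 1 by rewrite ler_norml; have := Qz x; rewrite !mxE.
  rewrite !normrM s1 mul1r normfV (gtr0_norm e0) (ger0_norm (ler0n _ 2)).
  suff H1 : `|oapp (z 0) (tau z) (unlift ord0 l)| <= 1.
    by apply: le_lt_trans (ler_piMr _ H1) _; rewrite ?divr_ge0 ?(ltW e0)// ltr_pdivrMr// ltr_pMr// ltr1n.
  case: (unlift ord0 l) => [x|] /=; first exact: zb.
  rewrite /tau ler_norml; apply/andP; split; last by rewrite gerBl sqnorm_ge0.
  have z2 x : z 0 x ^+ 2 <= 1 by rewrite -real_normK ?num_real// expr_le1.
  rewrite /sqnorm big_ord_recl big_ord1; have := z2 ord0; have := z2 (lift ord0 ord0).
  by move=> ? ?; lra.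
pose h s z := H (Psi (q (L s z))).
have cL s : continuous (L s).
  apply/cont_onT; apply: cont_onZ; first exact: cont_on_cst.
  apply: cont_on_consr; last exact: cont_on_id.
  apply: cont_onD; first exact: cont_on_cst.
  exact/cont_onN/cont_on_sqnorm/cont_on_id.
have ch s : `|s| = 1 -> cont_on Q (h s).
  move=> s1; apply: (cont_on_comp (f := fun z => Psi (q (L s z))) _ cH); last by move=> z; exact: NL.
  by apply: (cont_on_comp (f := L s) _ cPq) => //; exact: cont_on_continuous.
have n1 : `|1 : R| = 1 by rewrite normr1.
have nN1 : `|-1 : R| = 1 by rewrite normrN1.
apply: (@odd_circle R (fun z => (h 1 z).1 - (h (-1) z).1) (fun z => (h 1 z).2 - (h (-1) z).2)).
- by apply: cont_onD; [|apply: cont_onN]; apply: cont_on_fst; exact: ch.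
- by apply: cont_onD; [|apply: cont_onN]; apply: cont_on_snd; exact: ch.
- move=> z Qz; rewrite paddr_eq0 ?sqr_ge0// !sqrf_eq0 !subr_eq0; apply/negP => /andP[/eqP e1 /eqP e2].
  have hh : h 1 z = h (-1) z by move: e1 e2; case: (h 1 z) (h (-1) z) => ? ? [? ?] /= -> ->.
  have /(congr1 (fun e => (p e, W e))) := injH _ _ (NL _ _ n1 Qz) (NL _ _ nN1 Qz) hh.
  rewrite /q; have [-> ->] := PsiK _ (v0 + tailr (L 1 z)) (SnB (L 1 z 0 0)).
  have [-> ->] := PsiK _ (v0 + tailr (L (-1) z)) (SnB (L (-1) z 0 0)).
  move=> [/nB_inj E0 /addrI E1].
  have LL : L 1 z = L (-1) z by rewrite -(consr_tailr (L 1 z)) E0 E1 consr_tailr.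
  have e2n : e / 2 != 0 by rewrite mulf_neq0 ?gt_eqF// invr_gt0.
  have C0 : consr (tau z) z = 0.
    move: LL; rewrite /L mul1r mulN1r scaleNr => /eqP; rewrite eq_sym -subr_eq0 -opprD oppr_eq0.
    rewrite -scalerDl -mulr2n scaler_eq0 mulrn_eq0 (negbTE e2n) /= => /eqP//.
  have t0 : tau z = 0 by rewrite -(consr0 (tau z) z) C0 mxE.
  have z0 : z = 0 by rewrite -(consrK (tau z) z) C0; apply/rowP => x; rewrite !mxE.
  move: t0; rewrite /tau z0 /sqnorm big1 ?subr0; first by move/eqP; rewrite oner_eq0.
  by move=> x _; rewrite mxE expr0n.
- move=> z Sz; have tz (y : 'rV[R]_2) : sphere R 1 y -> tau y = 0.
    by move=> Sy; rewrite /tau (_ : sqnorm y = 1)// subrr.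
  have SNz : sphere R 1 (- z).
    by apply/sphereE; rewrite -scaleN1r sqnormZ sqrN1 mul1r.
  have LN s : L s (- z) = L (- s) z.
    rewrite /L !tz// mulNr scaleNr -scalerN; congr (_ *: _); apply/rowP => x.
    by case: (unliftP ord0 x) => [y|] ->; rewrite !mxE ?liftK ?unlift_none /= ?mxE ?oppr0.
  by rewrite /h !LN opprK !opprB.
Qed.

(** * Quotients by free finite actions *)

Section quotient.
Context {Nt N : topologicalType} {G : finGroupType} {act : G -> Nt -> Nt} {q : Nt -> N}.
Hypothesis quot : free_finite_quotient act q.

Lemma free_quotient_open A : open A -> open (q @` A).
Proof.
have [[act1 actM cact free] [cq sq opq fib]] := quot => oA; apply: opq.
rewrite (_ : q @^-1` _ = \bigcup_(g in setT) (act g @^-1` A)).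
  by apply: bigcup_open => g _; apply: open_comp => // x _; exact: cact.
apply/seteqP; split => [x [a Aa /esym/fib[g ax]]|x [g _ Ax]].
  by exists g => //; rewrite /preimage /= -ax.
by exists (act g x) => //; apply/esym/fib; exists g.
Qed.

(** By freeness and separation, [x0] has an open neighbourhood disjoint from its translates by each
    of the finitely many [g] other than 1. The quotient map is injective there, and its inverse is
    continuous because [q] is open. *)
Lemma local_section y0 : hausdorff_space Nt ->
  exists O s, [/\ open O, O y0, cont_on O s & forall y, O y -> q (s y) = y].
Proof.
have [[act1 actM cact free] [cq sq opq fib]] := quot => HN.
have [x0 qx0] := sq y0.
have sep g : exists D, [/\ open D, D x0 & g != 1%g -> forall x, D x -> ~ D (act g x)].
  have [->|g1] := eqVneq g 1%g; first by exists setT; split => //; exact: openT.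
  have xg : act g x0 != x0 by apply/eqP => /free/eqP; rewrite (negbTE g1).
  have := HN; rewrite open_hausdorff => /(_ _ _ xg)[[A B] /=].
  rewrite !inE => -[Ax Bx] [oA oB AB].
  exists (B `&` act g @^-1` A); split => //.
    by apply: openI => //; apply: open_comp => // x _; exact: cact.
  move=> _ x [Bx' Ax'] [Bg _]; rewrite -[False]/(set0 (act g x)) -AB; split => //.
have [D HD] := choice sep.
pose D0 := interior (\bigcap_(g in setT) D g).
have oD0 : open D0 by exact: open_interior.
have D0x : D0 x0.
  apply: (@filterS _ _ _ [set x | forall g, D g x]) => [x Dx g _|]; first exact: Dx.
  apply: filter_forall => g; have [oD Dx _] := HD g; exact: open_nbhs_nbhs.
have injD x y : D0 x -> D0 y -> q x = q y -> x = y.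
  move=> /interior_subset Dx /interior_subset Dy /fib[g yg].
  have [g1|g1] := eqVneq g 1%g; first by rewrite yg g1 act1.
  have [_ _ /(_ g1 x (Dx g I))] := HD g; case.
  by rewrite -yg; exact: Dy.
pose s y := xget x0 [set x | D0 x /\ q x = y].
have sP y : (q @` D0) y -> D0 (s y) /\ q (s y) = y.
  move=> [x D0x' qx]; apply: (@xgetPex _ x0 [set x | D0 x /\ q x = y]).
  by exists x.
exists (q @` D0), s; split.
- exact: free_quotient_open.
- by exists x0.
- move=> y Dy; have [Ds qs] := sP y Dy.
  move=> A; rewrite nbhsE => -[A' [oA' A's] A'A].
  rewrite nbhs_simpl /within /=.
  have oqA : open (q @` (A' `&` D0)) by apply: free_quotient_open; exact: openI.
  have qAy : (q @` (A' `&` D0)) y by exists (s y).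
  apply: filterS (open_nbhs_nbhs (conj oqA qAy)) => y' [x [A'x D0x'] qx] Dy'.
  have [Ds' qs'] := sP y' Dy'; apply: A'A.
  by rewrite (injD (s y') x)// qs'.
- by move=> y /sP[].
Qed.

End quotient.

(** * The end containing a fibre at infinity *)

(* [P r] is the circle of radius [r] in a fibre, [(T, Y)] are coordinates of the end [D] over
   [R x N] with inverse [g], and [xi] presents [N] as the quotient of a sphere by the action [al]. *)
Section simply_connected_end.
Context {R : realType} {E N : topologicalType} {G : finGroupType} {m : nat}.
Local Notation S := (sphere R m.+2).
Variables (w0 w1 : E -> R) (P : R -> R -> E) (D : set E) (r0 : R).
Variables (T : E -> R) (Y : E -> N) (g : R * N -> E).
Variables (xi : 'rV[R]_m.+3 -> N) (al : G -> 'rV[R]_m.+3 -> 'rV[R]_m.+3).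
Hypotheses (cw0 : continuous w0) (cw1 : continuous w1).
Hypothesis cPs : forall r, continuous (P r).
Hypothesis wP : forall r s, w0 (P r s) = r * cos s /\ w1 (P r s) = r * sin s.
Hypothesis P2pi : forall r, P r (pi *+ 2) = P r 0.
Hypotheses (r0_gt0 : 0 < r0) (PD : forall r s, r0 <= r -> D (P r s)).
Local Notation nW e := (w0 e ^+ 2 + w1 e ^+ 2).
Hypothesis compact_shell : forall r, r0 <= r -> compact ([set e | nW e = r ^+ 2] `&` D).
Hypotheses (cT : cont_on D T) (cY : cont_on D Y) (cg : continuous g).
Hypotheses (gD : forall z, D (g z)) (Tg : forall z, T (g z) = z.1).
Hypothesis gTY : forall e, D e -> g (T e, Y e) = e.
Hypothesis compactN : compact [set: N].
Hypotheses (cxi : cont_on S xi) (xi_surj : forall y, exists2 x, S x & xi x = y).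
Hypothesis xi_open : forall B, open B -> open (xi @` (B `&` S)).
Hypothesis al_sphere : forall c x, S x -> S (al c x).
Hypothesis cal : forall c, cont_on S (al c).
Hypothesis al1 : forall x, S x -> al 1%g x = x.
Hypothesis alM : forall c d x, S x -> al (c * d)%g x = al c (al d x).
Hypothesis xi_al : forall x x', S x -> S x' -> (xi x = xi x' <-> exists c, x' = al c x).

Lemma sqnorm_circle r s : nW (P r s) = r ^+ 2.
Proof. by have [-> ->] := wP r s; rewrite !exprMn -mulrDr cos2Dsin2 mulr1. Qed.

Lemma cont_nW : continuous (fun e => nW e).
Proof. by apply/cont_onT/cont_onD; apply/cont_onX/cont_onT. Qed.

(** The band of [D] where the radial coordinate lies in [[- c, c]] is compact, so [W] is bounded on
    it and large circles have to leave it. *)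
Lemma far_circle c : exists2 r, r0 <= r & forall r' s, r <= r' -> `|T (P r' s)| > c.
Proof.
have cpt : compact (g @` (`[- c, c]%classic `*` [set: N])).
  apply: compact_image; last exact: cont_on_continuous.
  by apply: compact_setX => //; exact: segment_compact.
have [M HM] := compact_ub cpt (cont_on_continuous cont_nW).
(* For a radius [r'] that is at least 1 and at least [M + 1], the value [r' ^+ 2] of the squared
   norm exceeds [M]. *)
pose r := Num.max r0 (Num.max 1 (M + 1)).
have [rr0 r1 rM] : [/\ r0 <= r, 1 <= r & M + 1 <= r].
  by rewrite /r !le_max !lexx !orbT.
exists r => // r' s rr'; rewrite ltNge; apply/negP => Tc.
have DP : D (P r' s) by apply: PD; exact: le_trans rr'.
have := HM (P r' s); rewrite sqnorm_circle => /(_ _)/wrap[].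
  exists (T (P r' s), Y (P r' s)); last exact: gTY.
  by split => //=; rewrite in_itv /= -ler_norml.
by rewrite expr2 => H; nra.
Qed.

Lemma cyl_snd t1 t2 : cont_on (@cyl R t1 t2 m.+2) (fun z => z.2).
Proof. exact/cont_on_snd/cont_on_id. Qed.

Section log.
Variables (t1 t2 : R) (th : R * 'rV[R]_m.+3 -> R).
Hypothesis t12 : t1 <= t2.
Hypothesis cth : cont_on (@cyl R t1 t2 m.+2) th.
Hypothesis hth : forall z, @cyl R t1 t2 m.+2 z ->
  is_arg (w0 (g (z.1, xi z.2))) (w1 (g (z.1, xi z.2))) (th z).

(** The change of argument under [al c] is a multiple of [2 pi], constant on the connected cylinder.
    Summed over the orbit of [c] it returns to zero after [#[c]] steps, so it vanishes: a finite
    group has no nonzero homomorphism to the integers. *)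
Lemma arg_invariant t x c : t1 <= t <= t2 -> S x -> th (t, al c x) = th (t, x).
Proof.
move=> tt Sx.
pose d z := th (z.1, al c z.2) - th z.
have calc : cont_on (@cyl R t1 t2 m.+2) (fun z => (z.1, al c z.2)).
  apply: (@cont_on_pair _ _ _ _ (fun z : R * 'rV[R]_m.+3 => z.1) (fun z => al c z.2)).
    exact/cont_on_fst/cont_on_id.
  by apply: (cont_on_comp (@cyl_snd t1 t2) (@cal c)) => z [].
have cyl_al z : @cyl R t1 t2 m.+2 z -> @cyl R t1 t2 m.+2 (z.1, al c z.2).
  by move=> [tz Sz]; split => //; exact: al_sphere.
have cd : cont_on (@cyl R t1 t2 m.+2) d.
  by apply: cont_onD; [exact: cont_on_comp calc cth cyl_al|exact: cont_onN].
have xial y : S y -> xi (al c y) = xi y.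
  by move=> Sy; apply/esym/xi_al => //; [exact: al_sphere|exists c].
have d1 z : @cyl R t1 t2 m.+2 z -> cos (d z) = 1.
  move=> cz; apply: is_arg_cosB (hth (cyl_al _ cz)) _.
  by rewrite /= xial; [exact: hth|case: cz].
have dk := connected_cos1_cst (@cyl_connected _ _ _ t12 m.+1) cd d1.
have cx y : S y -> @cyl R t1 t2 m.+2 (t, y) by split.
have iterE n : th (t, al (c ^+ n)%g x) = th (t, x) + d (t, x) *+ n.
  elim: n => [|n IH]; first by rewrite al1// addr0.
  have Sn : S (al (c ^+ n)%g x) by exact: al_sphere.
  rewrite expgS alM// mulrS addrCA -IH -(dk _ _ (cx _ Sn) (cx _ Sx)) /d /=.
  by rewrite subrK.
have := iterE #[c]%g; rewrite expg_order al1// => /eqP.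
rewrite addrC -subr_eq subrr eq_sym mulrn_eq0 eqn0Ngt order_gt0 /= /d /=.
by rewrite subr_eq0 => /eqP.
Qed.

Lemma descended_arg : exists Th : R * N -> R,
  cont_on [set z | t1 <= z.1 <= t2] Th /\
  forall z, t1 <= z.1 <= t2 -> is_arg (w0 (g z)) (w1 (g z)) (Th z).
Proof.
(* The section [sg] need not be continuous. Invariance makes [Th] independent of it, and continuity
   follows because [xi] is open. *)
have /choice[sg sgP] y : exists x, S x /\ xi x = y by have [x ? ?] := xi_surj y; exists x.
have thE t x : t1 <= t <= t2 -> S x -> th (t, sg (xi x)) = th (t, x).
  move=> tt Sx; have [Ssg /esym xsg] := sgP (xi x).
  by have /xi_al-/(_ Sx Ssg)[c ->] := xsg; exact: arg_invariant.
pose Th (z : R * N) : R := th (z.1, sg z.2).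
exists Th; split; last first.
  move=> [t y] /= tt; have [Sy xy] := sgP y.
  by have := @hth (t, sg y); rewrite /= xy; apply; split.
move=> [t y] /= tt A ThA; have [Sy xy] := sgP y.
have cz : @cyl R t1 t2 m.+2 (t, sg y) by split.
have := cth cz ThA; rewrite /= !nbhs_simpl /within /= => -[[B1 B2] /= [B1t B2y] B12].
move: B2y; rewrite nbhsE => -[B [oB By] BB2].
exists (B1, xi @` (B `&` S)).
  split => //=; apply: open_nbhs_nbhs; split; first exact: xi_open.
  by exists (sg y).
move=> [t' y'] [/= B1t' [x' [Bx' Sx'] <-]] tt'.
rewrite /Th /= thE//; apply: (B12 (t', x')); last by split.
by split => //=; exact: BB2.
Qed.

End log.

(** The level [r0] of [W] meets the end in a compact set, so beyond some height [c] the field [W]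
    never has norm [r0]. A connected cylinder above [c] containing a large circle then lies where
    the norm exceeds [r0], and on it [W] has an argument, which the winding of that circle
    forbids. *)
Lemma no_positive_ray : ~ exists r, forall r', r <= r' -> 0 < T (P r' 0).
Proof.
move=> [r1 Tpos].
have [c' Hc'] := compact_ub (compact_shell (lexx r0)) (cont_on_sub (@subIsetr _ _ _) cT).
pose c := Num.max c' 0.
have [c'c c0] : c' <= c /\ 0 <= c by rewrite /c !le_max !lexx orbT.
have [r2 r02 Hr2] := far_circle (c + 1).
pose r := Num.max (r0 + 1) (Num.max r1 r2).
have [rr0 rr1 rr2] : [/\ r0 + 1 <= r, r1 <= r & r2 <= r].
  by rewrite /r !le_max !lexx !orbT.
have DP s : D (P r s) by apply: PD; lra.
have cTP : cont_on [set: R] (fun s => T (P r s)).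
  by apply: (cont_on_comp _ cT) => //; apply/cont_onT.
(* Only one point of the circle is known to be on the positive side; the circle is connected and
   avoids height [c + 1], so the rest follows. *)
have TP s : c + 1 < T (P r s).
  apply: (@connected_pos _ _ setT (fun s => T (P r s)) (c + 1) 0) => //.
  - by apply/connected_intervalP.
  - by move=> x _; have := Hr2 r x rr2; rewrite ltr_normr => /orP[?|?]; apply/eqP => e; lra.
  - by have := Hr2 r 0 rr2; rewrite gtr0_norm ?Tpos.
have [t2 Ht2] := compact_ub (@segment_compact _ 0 (pi *+ 2)) (cont_on_sub (@subsetT _ _) cTP).
pose t1 := c + 1.
have pi0 : 0 < pi :> R := pi_gt0 R.
have tP s : 0 <= s <= pi *+ 2 -> t1 <= T (P r s) <= t2.
  by move=> ss; rewrite ltW ?TP//= Ht2//= in_itv.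
have I0 : (0 : R) <= 0 <= (pi : R) *+ 2 by rewrite lexx mulrn_wge0// ltW.
have t12 : t1 <= t2 by have /andP[] := tP 0 I0; exact: le_trans.
have cgx : cont_on (@cyl R t1 t2 m.+2) (fun z => g (z.1, xi z.2)).
  apply: continuous_cont_on => //.
  apply: (@cont_on_pair _ _ _ _ (fun z : R * 'rV[R]_m.+3 => z.1) (fun z => xi z.2)).
    exact/cont_on_fst/cont_on_id.
  by apply: (cont_on_comp (@cyl_snd t1 t2) cxi) => z [].
have [x0 Sx0 xi0] := xi_surj (Y (P r 0)).
have nWpos z : @cyl R t1 t2 m.+2 z -> r0 ^+ 2 < nW (g (z.1, xi z.2)).
  apply: (@connected_pos _ _ _ (fun z => nW (g (z.1, xi z.2))) (r0 ^+ 2) (T (P r 0), x0)).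
  - exact: cyl_connected.
  - exact: continuous_cont_on cont_nW cgx.
  - move=> [t x] [/= /andP[t1t _] Sx]; apply/eqP => e.
    have := Hc' (g (t, xi x)); rewrite Tg /= => /(_ _)/wrap[]; first by split.
    by rewrite /t1 in t1t; lra.
  - by split => //; exact: tP.
  - by rewrite /= xi0 gTY// sqnorm_circle ltr_sqr ?nnegrE; have := r0_gt0; lra.
have [th [cth hth]] := cyl_arg t12 (continuous_cont_on cw0 cgx) (continuous_cont_on cw1 cgx)
  (fun z cz => lt0r_neq0 (lt_trans (exprn_gt0 2 r0_gt0) (nWpos z cz))).
have [Th [cTh hTh]] := descended_arg t12 cth hth.
(* Along the circle the parameter [s] is also an argument of [W], so [phi] is constant; yet [P r]
   closes up after a full turn while [s] has grown by [2 pi]. *)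
pose phi s := Th (T (P r s), Y (P r s)) - s.
have cphi : cont_on `[0, pi *+ 2]%classic phi.
  apply: cont_onD; last exact/cont_onN/cont_on_id.
  apply: (cont_on_comp (f := fun s => (T (P r s), Y (P r s))) _ cTh) => [|s /=]; last first.
    by rewrite in_itv; exact: tP.
  apply: cont_on_pair; first exact: cont_on_sub cTP.
  by apply: (cont_on_comp (f := P r) _ cY) => //; apply: cont_on_continuous.
have phi1 s : `[0, pi *+ 2]%classic s -> cos (phi s) = 1.
  rewrite /= in_itv /= => ss; have := hTh (T (P r s), Y (P r s)) (tP s ss).
  rewrite gTY// => h; apply: is_arg_cosB h _; have [-> ->] := wP r s.
  by exists r => //; have := r0_gt0; lra.
have := connected_cos1_cst (@segment_connected _ 0 (pi *+ 2)) cphi phi1 (x := 0) (y := pi *+ 2).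
rewrite /= !in_itv /= !lexx mulrn_wge0 ?(ltW pi0)// => /(_ isT isT).
rewrite /phi P2pi subr0 => /eqP; rewrite -subr_eq0 opprB addrCA subrr addr0 mulrn_eq0 /=.
by rewrite gt_eqF.
Qed.

End simply_connected_end.

(** * Exclusion of low-dimensional links and conclusion *)

Lemma homeo_cont (T U : topologicalType) (A : set T) (B : set U) f g :
  homeo_between A B f g -> cont_on A f /\ cont_on B g.
Proof. by move=> [[/cont_onP cf /cont_onP cg _ _] _]. Qed.

Lemma hausdorff_homeo_sphere (R : realType) k (X : topologicalType)
    (f : X -> 'rV[R]_k.+1) g :
  homeo_between [set: X] (sphere R k) f g -> hausdorff_space X.
Proof.
move=> hom; have [/cont_onT cf _] := homeo_cont hom; case: hom => _ [fK _].
rewrite open_hausdorff => x y xy.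
have fxy : f x != f y by apply: contra_neq xy => fxy; rewrite -(fK x)// fxy fK.
have := @norm_hausdorff _ 'rV[R]_k.+1; rewrite open_hausdorff => /(_ _ _ fxy)[[A B] /=].
rewrite !inE => -[Ax By] [oA oB AB].
exists (f @^-1` A, f @^-1` B); rewrite ?inE //=; split.
- by apply: open_comp => // z _; exact: cf.
- by apply: open_comp => // z _; exact: cf.
- by rewrite -preimage_setI AB preimage_set0.
Qed.

(** For [l <= 1], polar coordinates put [(0,oo) x S^l] injectively into the plane, and a local
    section of the quotient map carries a neighbourhood of the given point there. *)
Lemma low_dim_end (R : realType) k (E : topologicalType)
    (p : E -> 'rV[R]_k.+2) (W : E -> 'rV[R]_2) (Psi : 'rV[R]_k.+2 * 'rV[R]_2 -> E)
    (D : set E) (N Nt : topologicalType) (f : E -> R * N) (g : R * N -> E)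
    (G : finGroupType) (act : G -> Nt -> Nt) (q : Nt -> N) l
    (a : Nt -> 'rV[R]_l.+1) (a' : 'rV[R]_l.+1 -> Nt) b0 v0 :
  cont_on [set z | sphere R k.+1 z.1] Psi ->
  (forall b v, sphere R k.+1 b -> p (Psi (b, v)) = b /\ W (Psi (b, v)) = v) ->
  sphere R k.+1 b0 -> open D -> D (Psi (b0, v0)) ->
  homeo_between D [set z : R * N | 0 < z.1] f g ->
  free_finite_quotient act q -> homeo_between [set: Nt] (sphere R l) a a' ->
  (1 < l)%N.
Proof.
move=> cPsi PsiK Sb0 oD De homD quot homN; rewrite ltnNge; apply/negP => l1.
have [cf _] := homeo_cont homD; have [ca _] := homeo_cont homN.
have HN := hausdorff_homeo_sphere homN.
case: homD => -[_ _ fpos _] [fK _]; case: homN => -[_ _ aS _] [aK _].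
have [ O [s [oO Oy cs qs]]] := local_section quot (f (Psi (b0, v0))).2 HN.
pose w e := a (s (f e).2).
pose D' := D `&` (fun e => (f e).2) @^-1` O.
have cf2 : cont_on D (fun e => (f e).2) by exact: cont_on_snd.
have oD' : open D' by exact: open_preim.
(* The first and last coordinates are all the coordinates when [l <= 1]; for [l = 0] they
   coincide. *)
pose H e : R * R := ((f e).1 * w e 0 ord0, (f e).1 * w e 0 ord_max).
have sub : D' `<=` D by move=> e [].
have cw : cont_on D' w.
  apply: (cont_on_comp (B := setT) _ ca) => //.
  by apply: (cont_on_comp (cont_on_sub sub cf2) cs) => e [].
apply: (@no_plane_embedding _ _ _ p W Psi D' H b0 v0) => //.
- apply: cont_on_pair; apply: cont_onM; try exact: cont_on_coord;
    exact/cont_on_fst/(cont_on_sub sub).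
- move=> e e' [De' Oe] [De'' Oe'] [H0 H1].
  have tw : (f e).1 *: w e = (f e').1 *: w e'.
    apply/rowP => i; rewrite !mxE.
    have [->//|i0] := eqVneq i ord0.
    have -> // : i = ord_max.
    apply/val_inj => /=; apply/eqP; rewrite eqn_leq -ltnS ltn_ord /=.
    by apply: leq_trans l1 _; rewrite lt0n.
  have w1 x : sqnorm (w x) = 1 by exact: aS.
  have t0 := fpos _ De'; have t0' := fpos _ De''.
  have t : (f e).1 = (f e').1.
    have := congr1 sqnorm tw; rewrite !sqnormZ !w1 !mulr1 => /eqP.
    by rewrite eqrXn2 ?ltW// => /eqP.
  have ww : w e = w e'.
    by move: tw; rewrite t => /scalerI; apply; rewrite gt_eqF.
  have ss : s (f e).2 = s (f e').2 by rewrite -(aK (s (f e).2))// -/(w e) ww aK.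
  have y : (f e).2 = (f e').2 by rewrite -(qs _ Oe) ss qs.
  by rewrite -(fK e)// -(fK e')//; congr g; move: t y; case: (f e) (f e') => ? ? [? ?] /= -> ->.
Qed.

Lemma connected_in_open (T : topologicalType) (C A B : set T) x :
  connected C -> open A -> open B -> A `&` B = set0 -> C `<=` A `|` B ->
  C x -> A x -> C `<=` A.
Proof.
move=> cC oA oB AB CAB Cx Ax.
have <- : C `&` A = C; last by move=> y [].
apply: cC; first by exists x.
- by exists A.
- exists (~` B); first exact: open_closedC.
  apply/seteqP; split => y [Cy]; last by case: (CAB y Cy).
  by move=> Ay; split => // By; have : (A `&` B) y by []; rewrite AB.
Qed.

Lemma sqnorm_level_compact (R : realType) m (c : R) : compact [set x : 'rV[R]_m | sqnorm x = c].
Proof.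
apply: (subclosed_compact _ (@box_compact R m (const_mx (- (c + 1))) (const_mx (c + 1)))).
  apply: (@closed_comp _ _ (fun x : 'rV[R]_m => sqnorm x) [set c]).
    by move=> x _; move: x; apply/cont_onT/cont_on_sqnorm/cont_on_id.
  exact: closed_eq.
move=> x /= xc i; rewrite !mxE -ler_norml.
have := sqnorm_coord x i; rewrite xc -real_normK ?num_real// => h.
by have := normr_ge0 (x 0 i); nra.
Qed.

Definition row2 {R : realType} (a b : R) : 'rV[R]_2 := \row_i (if i == 0 then a else b).

Theorem theorem2p8 (R : realType) (n : nat) (hn : (2 < n)%N)
  (E : topologicalType) (p : E -> 'rV[R]_(n.+1)) :
  rank_vector_bundle_over_sphere R n 2 E p -> ~ topALE R E.
Proof.
case: n hn p => [|[|[|k]]] // _ p bundle.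
have [W [Psi [cW cPsi PsiK WK]]] := bundle_trivial bundle.
have pS e : sphere R k.+3 (p e) by case: bundle => _ [].
move=> [_ [K [J [N [Ends [[cptK closedN disjE coverE openE] [homE quotE]]]]]]].
pose b0 : 'rV[R]_k.+4 := delta_mx 0 0.
have Sb0 : sphere R k.+3 b0 by apply/sphereE; exact: sqnorm_delta.
pose nW e := sqnorm (W e).
have cnW : continuous nW by apply/cont_onT/cont_on_sqnorm/cont_onT.
have nWE e : nW e = W e 0 0 ^+ 2 + W e 0 1 ^+ 2.
  by rewrite /nW /sqnorm big_ord_recl big_ord1; congr (_ + W e _ _ ^+ 2); apply/val_inj.
pose P r s := Psi (b0, row2 (r * cos s) (r * sin s)).
have WP r s : W (P r s) 0 0 = r * cos s /\ W (P r s) 0 1 = r * sin s.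
  by rewrite /P; have [_ ->] := PsiK b0 (row2 (r * cos s) (r * sin s)) Sb0; rewrite !mxE.
have nWP r s : nW (P r s) = r ^+ 2.
  by rewrite nWE; have [-> ->] := WP r s; rewrite !exprMn -mulrDr cos2Dsin2 mulr1.
have cP (h1 h2 : R -> R) : continuous h1 -> continuous h2 ->
    continuous (fun t => P (h1 t) (h2 t)).
  move=> /cont_onT c1 /cont_onT c2; apply/cont_onT.
  apply: (cont_on_comp (f := fun t => (b0, row2 (h1 t * cos (h2 t)) (h1 t * sin (h2 t)))) _ cPsi) => //.
  apply: (@cont_on_pair _ _ _ _ (fun=> b0)); first exact: cont_on_cst.
  apply: cont_on_mx => i j; have [->|j0] := eqVneq j 0.
    rewrite (_ : (fun t => _) = fun t => h1 t * cos (h2 t)); last by apply/funext => t; rewrite mxE.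
    by apply: cont_onM => //; exact: cont_on_cos.
  rewrite (_ : (fun t => _) = fun t => h1 t * sin (h2 t)); last first.
    by apply/funext => t; rewrite mxE (negbTE j0).
  by apply: cont_onM => //; exact: cont_on_sin.
have cid : continuous (@id R) by move=> x; exact: cvg_id.
have ccst (c : R) : continuous (fun _ : R => c) by move=> x; exact: cvg_cst.
have cPr s : continuous (P ^~ s) by exact: (cP id (fun=> s)).
have cPs r : continuous (P r) by exact: (cP (fun=> r) id).
have [M HM] := compact_ub cptK (cont_on_continuous cnW).
(* [M] bounds the squared norm of [W] on [K]; since [r0 >= 1], every level [r >= r0] has
   [r ^+ 2 >= M + 1] and misses [K]. *)
pose r0 := Num.max 1 (M + 1).
have [r01 r0M] : 1 <= r0 /\ M + 1 <= r0 by rewrite /r0 !le_max !lexx orbT.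
have r0_gt0 : 0 < r0 by lra.
have notK e r : r0 <= r -> nW e = r ^+ 2 -> ~ K e.
  by move=> rr0 er /HM; rewrite er; nra.
have PnK r s : r0 <= r -> ~ K (P r s) by move=> rr0; exact: notK (nWP r s).
have [j Ej] : exists j, Ends j (P r0 0).
  have : (~` K) (P r0 0) by exact: PnK.
  by rewrite -coverE => -[j _ ?]; exists j.
pose others := \bigcup_(i in [set i | i != j]) Ends i.
have oothers : open others by apply: bigcup_open => i _; exact: openE.
have disj : Ends j `&` others = set0.
  apply/seteqP; split => // e [ej [i /= ij ei]].
  by have : (Ends i `&` Ends j) e by []; rewrite disjE.
have cover e : ~ K e -> (Ends j `|` others) e.
  move=> nK; have : (~` K) e by []; rewrite -coverE => -[i _ ei].
  by have [<-|ij] := eqVneq i j; [left|right; exists i].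
(* The fibre outside the disc of radius [r0] is reached from [P r0 0] by a radius followed by a
   circle, both outside [K]; being connected, they cannot leave the open set [Ends j] for the other
   ends. *)
have PE r s : r0 <= r -> Ends j (P r s).
  move=> rr0; have Er : Ends j (P r 0).
    have conn : connected (P ^~ 0 @` `[r0, r]%classic).
      by apply: connected_image; [exact: segment_connected|exact: cont_on_continuous].
    apply: (connected_in_open conn (openE j) oothers disj _ _ Ej).
    - by move=> _ [t /= + <-]; rewrite in_itv /= => /andP[? _]; apply/cover/PnK.
    - by exists r0 => //; rewrite /= in_itv /= lexx.
    - by exists r => //; rewrite /= in_itv /= lexx rr0.
  have conn : connected (P r @` setT).
    by apply: connected_image; [exact/connected_intervalP|exact: cont_on_continuous].
  apply: (connected_in_open conn (openE j) oothers disj _ _ Er).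
  - by move=> _ [t _ <-]; exact/cover/PnK.
  - by exists 0.
  - by exists s.
have [f [g homj]] := homE j.
have [Nt [G [act [q [quot [l [a [a' homN]]]]]]]] := quotE j.
have : (1 < l)%N.
  exact: (low_dim_end cPsi PsiK Sb0 (openE j) (PE r0 0 (lexx r0)) homj quot homN).
case: l a a' homN => [|[|l]] // a a' homN _.
have [cf cg] := homeo_cont homj; have [ca ca'] := homeo_cont homN.
case: homj => -[_ _ fpos gE] [fK gK]; case: homN => -[_ _ aS _] [aK a'K].
have [[act1 actM cact _] [cq sq _ fib]] := quot.
(* The whole level set of [W] is the image of a sphere times a circle. It misses [K], so its part in
   [Ends j] is also its part off the open set [others], hence closed in it. *)
have shell r : r0 <= r -> compact ([set e | W e 0 0 ^+ 2 + W e 0 1 ^+ 2 = r ^+ 2] `&` Ends j).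
  move=> rr0.
  have cS : compact (Psi @` (sphere R k.+3 `*` [set v | sqnorm v = r ^+ 2])).
    apply: compact_image; first by apply: compact_setX; exact: sqnorm_level_compact.
    by apply: cont_on_sub cPsi => z [].
  rewrite (_ : _ `&` _ = (Psi @` (sphere R k.+3 `*` [set v | sqnorm v = r ^+ 2])) `&` ~` others).
    by apply: compact_closedI => //; exact: open_closedC.
  apply/seteqP; split => e [].
    move=> /= er ej; split; last by move=> oe; have : (Ends j `&` others) e by []; rewrite disj.
    by exists (p e, W e); rewrite ?WK//; split => //=; rewrite -/(nW e) nWE.
  move=> [[b v] [/= Sb vr] <-] no.
  have We : W (Psi (b, v)) = v by case: (PsiK b v Sb).
  have er : nW (Psi (b, v)) = r ^+ 2 by rewrite /nW We.
  by split; [rewrite /= -nWE|case: (cover _ (notK _ _ rr0 er))].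
(* The logarithm replaces [(0,oo)] by the whole line, where the two sides of the end are exchanged
   by a change of sign. *)
pose T e := ln (f e).1; pose Y e := (f e).2.
have cT : cont_on (Ends j) T.
  have cln : cont_on [set t : R | 0 < t] (@ln R).
    by move=> t t0; apply: cvg_within_filter; exact: continuous_ln.
  exact: (cont_on_comp (cont_on_fst cf) cln fpos).
have cY : cont_on (Ends j) Y by exact: cont_on_snd.
pose ge (z : R * N j) := g (expR z.1, z.2).
have exp_pos (z : R * N j) : [set z : R * N j | 0 < z.1] (expR z.1, z.2) by exact: expR_gt0.
have cge s : cont_on setT (fun z : R * N j => ge (s * z.1, z.2)).
  apply: (cont_on_comp (f := fun z : R * N j => (expR (s * z.1), z.2)) _ cg) => [|z _]; last exact: expR_gt0.
  apply: (@cont_on_pair _ _ _ _ (fun z : R * N j => expR (s * z.1)) (fun z => z.2)).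
    apply: continuous_cont_on; first exact: continuous_expR.
    by apply: cont_onM; [exact: cont_on_cst|exact/cont_on_fst/cont_on_id].
  exact/cont_on_snd/cont_on_id.
have geD z : Ends j (ge z) by apply: gE; exact: exp_pos.
have Tge z : T (ge z) = z.1 by rewrite /T /ge gK ?expRK//; exact: exp_pos.
have geTY e : Ends j e -> ge (T e, Y e) = e.
  move=> ee; rewrite /ge /T /Y lnK ?posrE; last exact: fpos.
  by rewrite -[RHS](fK e ee); case: (f e).
have cptN : compact [set: N j] by case: (closedN j).
pose xi x := q (a' x).
pose al c x := a (act c (a' x)).
have cxi : cont_on (sphere R l.+2) xi by exact: continuous_cont_on.
have xi_surj y : exists2 x, sphere R l.+2 x & xi x = y.
  have [x <-] := sq y; exists (a x); first exact: aS.
  by rewrite /xi aK.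
have xi_open B : open B -> open (xi @` (B `&` sphere R l.+2)).
  move=> oB; rewrite (_ : _ @` _ = q @` (a @^-1` B)).
    apply: (free_quotient_open quot); have := open_preim ca openT oB.
    by rewrite setTI.
  apply/seteqP; split => [_ [x [Bx Sx] <-]|_ [x Bx <-]].
    by exists (a' x) => //; rewrite /preimage /= a'K.
  by exists (a x); [split => //; exact: aS|rewrite /xi aK].
have al_sphere c x : sphere R l.+2 x -> sphere R l.+2 (al c x) by move=> _; exact: aS.
have cal c : cont_on (sphere R l.+2) (al c).
  apply: (cont_on_comp (f := fun x => act c (a' x)) _ ca) => //.
  by apply: continuous_cont_on ca'; exact: cact.
have al1 x : sphere R l.+2 x -> al 1%g x = x by move=> Sx; rewrite /al act1 a'K.
have alM c d x : sphere R l.+2 x -> al (c * d)%g x = al c (al d x).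
  by move=> Sx; rewrite /al actM aK.
have xi_al x x' : sphere R l.+2 x -> sphere R l.+2 x' ->
    (xi x = xi x' <-> exists c, x' = al c x).
  move=> Sx Sx'; rewrite /xi fib; split => -[c cx]; exists c.
    by rewrite /al -cx a'K.
  by rewrite cx /al aK.
have P2pi r : P r (pi *+ 2) = P r 0.
  by rewrite /P cos2pi sin2pi cos0 sin0.
have cw i : continuous (fun e => W e 0 i) by apply/cont_onT/cont_on_coord/cont_onT.
(* Applying [no_positive_ray] to the coordinate [s * T] covers both sides of the end. *)
have ray s : s ^+ 2 = 1 -> ~ exists r, forall r', r <= r' -> 0 < s * T (P r' 0).
  move=> s1.
  have ss (t : R) : s * (s * t) = t by rewrite mulrA -expr2 s1 mul1r.
  apply: (@no_positive_ray _ _ _ _ _ (fun e => W e 0 0) (fun e => W e 0 1) P (Ends j) r0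
    (fun e => s * T e) Y (fun z => ge (s * z.1, z.2)) xi al) => //.
  - by apply: cont_onM => //; exact: cont_on_cst.
  - exact/cont_onT.
  - by move=> z; rewrite Tge ss.
  - by move=> e ee; rewrite /= ss geTY.
have cge1 : continuous ge.
  apply/cont_onT; apply: cont_on_eq (cge 1) => -[z1 z2] _; by rewrite mul1r.
have [r rr0 Tfar] := far_circle (cw 0) (cw 1) WP PE cge1 geTY cptN 0.
have Tn0 r' : r <= r' -> T (P r' 0) != 0.
  by move=> rr; have := Tfar r' 0 rr; rewrite normr_gt0.
have cTr : cont_on `[r, +oo[%classic (fun r' => T (P r' 0)).
  apply: (cont_on_comp (f := P ^~ 0) _ cT) => [|r' /=]; first exact: cont_on_continuous.
  by rewrite in_itv /= andbT => rr'; apply: PE; exact: le_trans rr'.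
have conn : connected `[r, +oo[%classic by apply/connected_intervalP; exact: interval_is_interval.
have inr r' : r <= r' -> `[r, +oo[%classic r' by rewrite /= in_itv /= andbT.
have T0 x : `[r, +oo[%classic x -> T (P x 0) != 0 by rewrite /= in_itv /= andbT; exact: Tn0.
have := Tn0 r (lexx r); rewrite neq_lt => /orP[Tr|Tr].
  apply: (ray (-1)); first exact: sqrN1.
  exists r => r' rr'; rewrite mulN1r oppr_gt0.
  exact: (connected_neg conn cTr T0 (inr r (lexx r)) Tr (inr r' rr')).
apply: (ray 1); first exact: sqr1.
exists r => r' rr'; rewrite mul1r.
exact: (connected_pos conn cTr T0 (inr r (lexx r)) Tr (inr r' rr')).
Qed.
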